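(* Let $\Delta$ be a finite reduced root system of rank $r$, $\mathbf{y}\in V$, and $\mathbf{t}=(t_\alpha)_{\alpha\in\Delta_+}$ with $|t_\alpha|<2\pi$. Then $$\begin{aligned}F(\mathbf{t},\mathbf{y};\Delta)&=\biggl(\prod_{\alpha\in\Delta_+}\frac{t_\alpha}{e^{t_\alpha}-1}\biggr)\int_0^1\!\!\cdots\!\int_0^1\Bigl(\prod_{\alpha\in\Delta_+\setminus\Psi}\exp(t_\alpha x_\alpha)\Bigr)\\&\qquad\times\biggl(\prod_{i=1}^r\exp\Bigl(t_{\alpha_i}\Bigl\{\langle\mathbf{y},\lambda_i\rangle-\sum_{\alpha\in\Delta_+\setminus\Psi}x_\alpha\langle\alpha^\vee,\lambda_i\rangle\Bigr\}\Bigr)\biggr)\prod_{\alpha\in\Delta_+\setminus\Psi}dx_\alpha\\&=\biggl(\prod_{\alpha\in\Delta_+}\frac{t_\alpha}{e^{t_\alpha}-1}\biggr)\sum_{m_1=0}^{2\langle\rho^\vee,\lambda_1\rangle-1}\cdots\sum_{m_r=0}^{2\langle\rho^\vee,\lambda_r\rangle-1}\exp\Bigl(\sum_{i=1}^rt_{\alpha_i}(\{\langle\mathbf{y},\lambda_i\rangle\}+m_i)\Bigr)\\&\qquad\times\int_{\mathcal{P}_{\mathbf{m},\mathbf{y}}}\exp\Bigl(\sum_{\alpha\in\Delta_+\setminus\Psi}t^*_\alpha x_\alpha\Bigr)\prod_{\alpha\in\Delta_+\setminus\Psi}dx_\alpha,\end{aligned}$$ where $\rho^\vee=\frac12\sum_{\alpha\in\Delta_+}\alpha^\vee$,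 $t^*_\alpha=t_\alpha-\sum_{i=1}^rt_{\alpha_i}\langle\alpha^\vee,\lambda_i\rangle$, $\mathbf{m}=(m_1,\dots,m_r)$, and $$\mathcal{P}_{\mathbf{m},\mathbf{y}}=\Bigl\{(x_\alpha)_{\alpha\in\Delta_+\setminus\Psi}\ \Big|\ 0\le x_\alpha\le1\ (\alpha\in\Delta_+\setminus\Psi),\ \{\langle\mathbf{y},\lambda_i\rangle\}+m_i-1\le\sum_{\alpha\in\Delta_+\setminus\Psi}x_\alpha\langle\alpha^\vee,\lambda_i\rangle\le\{\langle\mathbf{y},\lambda_i\rangle\}+m_i\ (1\le i\le r)\Bigr\}$$ is a (possibly empty) convex polytope. In particular, if $\Delta$ is irreducible and not of type $A_1$, then with $\mathcal{P}_{\mathbf{m}}=\mathcal{P}_{\mathbf{m},0}$, $$F(\mathbf{t};\Delta)=\biggl(\prod_{\alpha\in\Delta_+}\frac{t_\alpha}{e^{t_\alpha}-1}\biggr)\sum_{m_1=1}^{2\langle\rho^\vee,\lambda_1\rangle-1}\cdots\sum_{m_r=1}^{2\langle\rho^\vee,\lambda_r\rangle-1}\exp\Bigl(\sum_{i=1}^rt_{\alpha_i}m_i\Bigr)\int_{\mathcal{P}_{\mathbf{m}}}\exp\Bigl(\sum_{\alpha\in\Delta_+\setminus\Psi}t^*_\alpha x_\alpha\Bigr)\prod_{\alpha\in\Delta_+\setminus\Psi}dx_\alpha.$$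
   Context: Root systems: $V$ is an $r$-dimensional real inner product space, $V^*$ is identified with $V$; $\Delta\subset V$ is a finite reduced root system, $\Psi=\{\alpha_1,\dots,\alpha_r\}$ a fundamental system, $\Delta_+$ the positive roots, $\alpha^\vee$ the coroot of $\alpha$; fundamental weights $\lambda_j$ satisfy $\langle\alpha_i^\vee,\lambda_j\rangle=\delta_{ij}$. $\{x\}=x-[x]$ is the fractional part of a real number $x$; $B_k(x)$ is the $k$-th Bernoulli polynomial; $t/(e^t-1)$ is $1$ at $t=0$. For $\mathbf{k}=(k_\alpha)\in\mathbb{Z}_{\ge0}^{|\Delta_+|}$ and $\mathbf{y}\in V$, $$P(\mathbf{k},\mathbf{y};\Delta)=\int_0^1\!\!\cdots\!\int_0^1\Bigl(\prod_{\alpha\in\Delta_+\setminus\Psi}B_{k_\alpha}(x_\alpha)\Bigr)\biggl(\prod_{i=1}^rB_{k_{\alpha_i}}\Bigl(\Bigl\{\langle\mathbf{y},\lambda_i\rangle-\sum_{\alpha\in\Delta_+\setminus\Psi}x_\alpha\langle\alpha^\vee,\lambda_i\rangle\Bigr\}\Bigr)\biggr)\prod_{\alpha\in\Delta_+\setminus\Psi}dx_\alpha,$$ and the generating functions are $$F(\mathbf{t},\mathbf{y};\Delta)=\sum_{\mathbf{k}\in\mathbb{Z}_{\ge0}^{|\Delta_+|}}P(\mathbf{k},\mathbf{y};\Delta)\prod_{\alpha\in\Delta_+}\frac{t_\alpha^{k_\alpha}}{k_\alpha!},\qquad F(\mathbf{t};\Delta)=F(\mathbf{t},0;\Delta)\qquad(|t_\alpha|<2\pi).$$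 If $\Delta_+\setminus\Psi=\emptyset$, integrals over $\mathbb{R}^{0}$ are values at the single point. *)

(* Defs.v *)
From HB Require Import structures.
From mathcomp Require Import all_boot all_order all_algebra finmap complex.
From mathcomp Require Import all_classical all_reals all_analysis.
From mathcomp Require Import summability convex.

Set Implicit Arguments.
Unset Strict Implicit.
Unset Printing Implicit Defensive.

Import Order.TTheory GRing.Theory Num.Theory.
Import numFieldNormedType.Exports.

Local Open Scope classical_set_scope.
Local Open Scope fset_scope.
Local Open Scope complex_scope.
Local Open Scope ring_scope.

Section RealAndComplex.
Variable R : realType.

Definition fracpart (x : R) : R := x - (Num.floor x)%:~R.

(* Comparing the coefficients of t^(n+1) in
     (e^t - 1) * (\sum_k B_k(x) t^k / k!) = t e^(xt)
   gives \sum_(k <= n) 'C(n+1, k) B_k(x) = (n+1) x^n, which is solved for B_n. *)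
Fixpoint bernoulli_seq (n : nat) : seq {poly R} :=
  if n is m.+1 then
    let s := bernoulli_seq m in
    rcons s ('X^m - m.+1%:R^-1 *: \sum_(k < m) 'C(m.+1, k)%:R *: s`_k)
  else [::].

Definition bernoulli_poly (k : nat) : {poly R} := (bernoulli_seq k.+1)`_k.

Lemma size_bernoulli_seq n : size (bernoulli_seq n) = n.
Proof. by elim: n => //= n IHn; rewrite size_rcons IHn. Qed.

Lemma nth_bernoulli_seq n k :
  (k < n)%N -> (bernoulli_seq n)`_k = bernoulli_poly k.
Proof.
elim: n => // n IHn; rewrite ltnS leq_eqVlt => /predU1P[-> //|ltkn] /=.
by rewrite nth_rcons size_bernoulli_seq ltkn IHn.
Qed.

Lemma bernoulli_polyE n :
  \sum_(k < n.+1) 'C(n.+1, k)%:R *: bernoulli_poly k = n.+1%:R *: 'X^n.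
Proof.
rewrite big_ord_recr /= {2}/bernoulli_poly /= nth_rcons size_bernoulli_seq.
rewrite ltnn eqxx binSn scalerBr scalerA mulfV ?pnatr_eq0// scale1r.
under [X in _ - X]eq_bigr => k _ do rewrite nth_bernoulli_seq//.
by rewrite addrC subrK.
Qed.

Definition cexp (z : R[i]) : R[i] :=
  (expR (complex.Re z))%:C * (cos (complex.Im z) +i* sin (complex.Im z)).

Definition todd (t : R[i]) : R[i] :=
  if t == 0 then 1 else t / (cexp t - 1).

End RealAndComplex.

(* Integrals over R^I: iterated one-dimensional Lebesgue integrals, in the order
   of [enum I]; every integrand below is bounded, Borel measurable and zero
   outside [0, 1]^I (or integrated over [0, 1]^I), so that by Fubini the order
   is immaterial.  If [I] is empty the integral is the value at the single
   point. *)
Section IteratedIntegrals.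
Variables (R : realType) (I : finType).
Local Notation pt := {ffun I -> R^o}.

Definition upd (x : pt) (i : I) (u : R) : pt :=
  [ffun j => if j == i then u else x j].

Fixpoint iint_seq (D : set R) (f : pt -> R) (s : seq I) (x : pt) : R :=
  if s is i :: s' then
    \int[@lebesgue_measure R]_(u in D) iint_seq D f s' (upd x i u)
  else f x.

Definition iint (D : set R) (f : pt -> R) : R := iint_seq D f (enum I) 0.

Definition ciint (D : set R) (f : pt -> R[i]) : R[i] :=
  iint D (fun x => complex.Re (f x)) +i* iint D (fun x => complex.Im (f x)).

Definition int_cube (f : pt -> R) : R := iint `[0, 1] f.

Definition cint_cube (f : pt -> R[i]) : R[i] := ciint `[0, 1] f.

Definition cint_over (P : set pt) (f : pt -> R[i]) : R[i] :=
  ciint setT (fun x => if x \in P then f x else 0).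

End IteratedIntegrals.

Definition convex_polytope (R : realType) (E : lmodType R) (P : set E) : Prop :=
  exists2 X : set E, finite_set X & P = smallest (@convex_set R E) X.

Section RootSystems.
Variables (R : realType) (V : vectType R) (form : {dot V for (@idfun R)}).

Definition coroot (a : V) : V := (2 / form a a) *: a.

Definition reflection (a v : V) : V := v - form (coroot a) v *: a.

Definition reduced_root_system (D : {fset V}) : Prop :=
  [/\ <<D>>%VS = fullv,
      0 \notin D,
      forall a b, a \in D -> b \in D -> reflection a b \in D,
      forall a b, a \in D -> b \in D -> form (coroot a) b \is a Num.int
    & forall (a : V) (c : R), a \in D -> c *: a \in D -> c = 1 \/ c = -1].

Definition fundamental_system (r : nat) (D : {fset V}) (psi : r.-tuple V) :
    Prop :=
  [/\ basis_of fullv psi,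
      forall i, tnth psi i \in D
    & forall b, b \in D ->
        (forall i, coord psi i b \is a Num.nat) \/
        (forall i, - coord psi i b \is a Num.nat)].

Record based_root_system (r : nat) := BasedRootSystem {
  root_set : {fset V};
  simple_roots : r.-tuple V;
  rootsP : reduced_root_system root_set;
  simpleP : fundamental_system root_set simple_roots }.

Definition irreducible_roots (D : {fset V}) : Prop :=
  D != fset0 /\
  ~ exists D1 D2 : {fset V},
      [/\ D1 != fset0, D2 != fset0, D = D1 `|` D2
        & forall a b, a \in D1 -> b \in D2 -> form a b = 0].

Definition type_A1 (D : {fset V}) : Prop :=
  exists a : V, D = [fset a; - a].

Section Fix_S.
Variables (r : nat) (S : based_root_system r).

Definition pos_roots : {fset V} :=
  [fset a in root_set S | [forall i, 0 <= coord (simple_roots S) i a]].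

Lemma simple_in_pos i : tnth (simple_roots S) i \in pos_roots.
Proof.
have [/andP[_ freeS] simpleD _] := simpleP S.
rewrite !inE simpleD /=; apply/forallP => j.
by rewrite (tnth_nth 0) coord_free// ler0n.
Qed.

Definition simple_root (i : 'I_r) : pos_roots := [` simple_in_pos i].

Definition nonsimple : finType := {a : pos_roots | val a \notin simple_roots S}.

Definition corho : V := 2^-1 *: \sum_(a : pos_roots) coroot (val a).

Variable lam : 'I_r -> V.

Definition fundamental_weights : Prop :=
  forall i j, form (coroot (tnth (simple_roots S) i)) (lam j) = (i == j)%:R.

Definition pairing (a : pos_roots) (i : 'I_r) : R :=
  form (coroot (val a)) (lam i).

Local Notation pt := {ffun nonsimple -> R^o}.

Definition lform (x : pt) (i : 'I_r) : R :=
  \sum_(a : nonsimple) (x a : R) * pairing (val a) i.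

Definition P_coef (k : {ffun pos_roots -> nat}) (y : V) : R :=
  int_cube (fun x : pt =>
    (\prod_(a : nonsimple) (bernoulli_poly R (k (val a))).[x a]) *
    \prod_(i < r) (bernoulli_poly R (k (simple_root i))).[
                     fracpart (form y (lam i) - lform x i)]).

Variable t : pos_roots -> R[i].

Definition genfun_term (y : V) (k : {ffun pos_roots -> nat}) : R[i]^o :=
  (P_coef k y)%:C * \prod_(a : pos_roots) (t a ^+ k a / (k a)`!%:R).

(* Unordered sum: limit of the finite partial sums over all finite sets of
   multi-indices [k]. *)
Definition genfun_converges (y : V) : Prop :=
  cvg (partial_sum (genfun_term y) A @[A --> totally]).

Definition genfun (y : V) : R[i] := summability.sum (genfun_term y).

Definition tstar (a : nonsimple) : R[i] :=
  t (val a) - \sum_(i < r) t (simple_root i) * (pairing (val a) i)%:C.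

(* 2 <rho^v, lambda_i>, which is a nonnegative integer, as a [nat] *)
Definition mbound (i : 'I_r) : nat := Num.truncn (2 * form corho (lam i)).

Definition mindex := {dffun forall i : 'I_r, 'I_(mbound i)}.

Definition polytope (m : 'I_r -> nat) (y : V) : set pt :=
  [set x : pt |
    (forall a, 0 <= (x a : R) <= 1) /\
    (forall i, fracpart (form y (lam i)) + (m i)%:R - 1 <= lform x i
                 <= fracpart (form y (lam i)) + (m i)%:R)].

End Fix_S.

End RootSystems.

(* Main.v *)
(* Put b_k = B_k / k!.  The only analytic input is that sum_k b_k(x) t^k converges
   to t e^{tx} / (e^t - 1) in the full disc |t| < 2 pi, and it is obtained on the
   real line.  Formally H(t) = t / (e^t - 1) + t / 2 solves the Riccati equation
   t H' = H - H^2 + t^2 / 4, so the absolute values of its coefficients satisfy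
   the recursive inequality (n+1) |h_n| <= [n=2] / 4 + sum_{0<k<n} |h_k| |h_{n-k}|.
   The function w(x) = 1 - (x/2) cot(x/2) satisfies (x w)' = x^2/4 + w^2 on
   (0, 2 pi), hence by induction it dominates all partial sums of
   sum_{n>0} |h_n| x^n.  The value of the sum follows from
   d/dx (g_N(x) e^{-tx}) = - t^{N+1} b_N(x) e^{-tx} for the partial sums g_N,
   together with g_N(1) - g_N(0) = t.

   The generating function is then a uniform limit under the integral sign.
   On the unit cube, outside finitely many hyperplanes, exactly one polytope
   contains x, and on it the fractional part of <y, lambda_i> - z_i is
   {<y, lambda_i>} + m_i - z_i.  The bound for m_i uses that 2 <rho^v, lambda_i>
   is an integer: by induction on the height, simple reflections show that
   coroots are integral combinations of simple coroots. *)

Require Import Defs.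
From HB Require Import structures.
From mathcomp Require Import all_boot all_order all_algebra finmap complex.
From mathcomp Require Import all_classical all_reals all_analysis.
From mathcomp Require Import summability convex.
From mathcomp Require Import measurable_realfun ring lra zify.

Set Implicit Arguments.
Unset Strict Implicit.
Unset Printing Implicit Defensive.

Import Order.TTheory GRing.Theory Num.Theory.
Import numFieldNormedType.Exports.

Local Open Scope classical_set_scope.
Local Open Scope fset_scope.
Local Open Scope complex_scope.
Local Open Scope ring_scope.

(** * Power series of the Bernoulli polynomials *)

Section BernoulliAlgebra.
Variable R : realType.

(** The radius 2 pi is classically read off from the nearest nonzero zero of e^t - 1; here it is the
    blow-up point of a real differential equation. The series H is (t/2) coth(t/2): its odd
    coefficients vanish and the even ones of positive degree alternate in sign, so passing to
    absolute values turns coth into cot. The |h_n| with n > 0 are exactly the Taylor coefficients of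
    1 - (x/2) cot(x/2), hence the majorant loses nothing and is finite up to 2 pi. Absolute
    convergence is what the unordered sum over multi-indices calls for. The majorant does not depend
    on the point of the cube, so the limit is uniform in spite of the jumps of the fractional parts.
    A hyperplane is negligible only if its linear form is nonzero. If all non-simple coroots pair to
    0 with lambda_i, then 2 <rho^v, lambda_i> = 1, only m_i = 0 occurs, and no face has to be
    discarded. Irreducibility together with the exclusion of A_1 rules this case out; for y = 0 the
    terms with m_i = 0 then live on a genuine hyperplane, which gives the last formula. *)

Definition nbern (k : nat) : {poly R} := k`!%:R^-1 *: bernoulli_poly R k.

Lemma nbern_conv n :
  \sum_(k < n.+1) (n.+1 - k)`!%:R^-1 *: nbern k = n`!%:R^-1 *: 'X^n.
Proof.
have f0 m : m`!%:R != 0 :> R by rewrite pnatr_eq0 -lt0n fact_gt0.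
have := congr1 (fun p => (n.+1)`!%:R^-1 *: p) (bernoulli_polyE R n).
rewrite scalerA factS natrM invfM -mulrA mulrCA mulVf ?pnatr_eq0// mulr1.
move=> <-; rewrite scaler_sumr; apply: eq_bigr => k _.
rewrite /nbern !scalerA; congr (_ *: _).
have kn : (k <= n.+1)%N by rewrite ltnW.
have := bin_fact kn => /(congr1 (fun m => m%:R : R)).
rewrite factS !natrM => e.
apply: (mulfI (f0 (n.+1 - k)%N)); rewrite mulVKf//.
apply: (mulfI (f0 k)); rewrite mulfV//.
apply: (mulfI (f0 n)).
apply: (@mulfI _ (n.+1%:R)); first by rewrite pnatr_eq0.
transitivity (('C(n.+1, k)%:R * (k`!%:R * (n.+1 - k)`!%:R)) : R).
  by rewrite e mulr1.
have n0 : n.+1%:R != 0 :> R by rewrite pnatr_eq0.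
move: (f0 n) (f0 k) (f0 (n.+1 - k)%N) n0.
move: (n`!%:R) (k`!%:R) ((n.+1 - k)`!%:R) (n.+1%:R) => a b c d a0 b0 c0 d0.
by field; rewrite a0.
Qed.

Lemma nbern0 : nbern 0 = 1.
Proof.
have := nbern_conv 0; rewrite big_ord_recl big_ord0 /= addr0 subn0 fact0.
by rewrite (_ : 1`! = 1%N)// invr1 !scale1r expr0.
Qed.

(** Differentiating the convolution identity at index k + 1 yields the identity at index k. The
    lower terms agree by induction, so the top terms agree too. *)
Lemma nbern_deriv k : (nbern k.+1)^`() = nbern k.
Proof.
elim/ltn_ind: k => k IH.
have := congr1 (fun p => p^`()) (nbern_conv k.+1).
rewrite big_ord_recl derivD raddf_sum /= derivZ nbern0 derivC scaler0 add0r.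
have fE : (k.+1)`!%:R^-1 *: ('X^k *+ k.+1) = k`!%:R^-1 *: 'X^k :> {poly R}.
  rewrite -[_ *+ k.+1]scaler_nat scalerA factS natrM invfM mulrAC mulVf ?pnatr_eq0//.
  by rewrite mul1r.
rewrite derivZ derivXn /= fE -(nbern_conv k).
rewrite big_ord_recr [RHS]big_ord_recr /=.
have bE m : bump 0 m = m.+1 by [].
under eq_bigr => i _ do rewrite derivZ bE IH// subSS.
move=> /addrI; rewrite derivZ bE subSS subSn// subnn /= => /scalerI -> //.
Qed.

Definition bnum (k : nat) : R := (nbern k).[0].

Lemma bnum_conv n :
  \sum_(k < n.+1) bnum k * (n.+1 - k)`!%:R^-1 = (n == 0%N)%:R.
Proof.
have := congr1 (fun p => p.[0]) (nbern_conv n).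
rewrite hornerZ hornerXn horner_sum expr0n => e.
rewrite (eq_bigr (fun k : 'I_n.+1 => (((n.+1 - k)`!)%:R^-1 *: nbern k).[0])).
  by rewrite e; case: n {e} => [|n]; rewrite ?mulr0// mulr1 invr1.
by move=> k _; rewrite hornerZ mulrC.
Qed.

(** Congruence modulo 'X^n with an explicit quotient: identities of formal power series can then be
    checked on truncations by polynomial algebra. *)
Lemma poly_low0 (n : nat) (p : {poly R}) :
  (forall i, (i < n)%N -> p`_i = 0) -> exists q, p = q * 'X^n.
Proof.
move=> p0; exists (drop_poly n p); rewrite -[LHS](poly_take_drop n).
rewrite (_ : take_poly n p = 0) ?add0r//; apply/polyP => i.
by rewrite coef_take_poly coef0; case: ifP => // /p0.
Qed.

(** Coefficients of (t/2) coth(t/2). Adding t/2 cancels the linear coefficient -1/2 of t / (e^t - 1)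
    and removes the term t T from the differential equation. *)
Definition hnum (k : nat) : R := bnum k + (k == 1%N)%:R / 2.

(* Formally, [T = t / (e^t - 1)] satisfies [t T' = T - t T - T^2], so that
   [H = T + t / 2] satisfies the Riccati equation [t H' = H - H^2 + t^2 / 4]. *)
Lemma hnum_riccati n :
  n%:R * hnum n =
  hnum n - \sum_(k < n.+1) hnum k * hnum (n - k) + (n == 2%N)%:R / 4.
Proof.
pose N := n.+1.
(* [T] truncates t / (e^t - 1) and [E] truncates (e^t - 1) / t. Modulo 'X^N they satisfy T E = 1 and
   t E' = t E + 1 - E. *)
pose T := \poly_(i < N) bnum i.
pose E := \poly_(i < N) (i.+1`!%:R^-1 : R).
have coefT i : (i < N)%N -> T`_i = bnum i by rewrite coef_poly => ->.
have coefE' i : (i < N)%N -> E`_i = i.+1`!%:R^-1 by rewrite coef_poly => ->.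
have [r rE] : exists r, T * E - 1 = r * 'X^N.
  apply: poly_low0 => i iN; rewrite coefB coef1 coefM.
  rewrite (eq_bigr (fun k : 'I_i.+1 => bnum k * (i.+1 - k)`!%:R^-1)).
    by rewrite bnum_conv subrr.
  move=> k _; have ki : (k <= i)%N by rewrite -ltnS.
  rewrite coefT ?(leq_ltn_trans ki iN)// coefE'; last first.
    by rewrite (leq_ltn_trans _ iN)// leq_subr.
  by rewrite subSn.
have [s sE] : exists s, 'X * E^`() - ('X * E + 1 - E) = s * 'X^N.
  apply: poly_low0 => -[|i] iN; rewrite coefB coefB coefD !coefXM coef1 /=.
    by rewrite coefE' // (_ : 1`! = 1%N)// invr1; ring.
  rewrite coef_deriv !coefE'// ?(ltnW iN)//= addr0.
  rewrite !factS !natrM -[_ *+ i.+1]mulr_natr.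
  field; rewrite !pnatr_eq0 /= -lt0n fact_gt0 /=.
  by rewrite -(natrD _ 1 i) -(natrD _ 2 i) !pnatr_eq0.
pose H := T + 2^-1 *: 'X.
have [q qE] : exists q, 'X * H^`() - (H - H ^+ 2 + 4^-1 *: 'X^2) = q * 'X^N.
  have dr : T^`() * E + T * E^`() = r^`() * 'X^N + r * (N%:R * 'X^n).
    have := congr1 (fun p => p^`()) rE.
    by rewrite derivB derivM -polyC1 derivC subr0 derivM derivXn mulr_natl.
  have XN : 'X^N = 'X * 'X^n :> {poly R} by rewrite exprS.
  pose h : {poly R} := (2^-1)%:P.
  have h2 : h * 2 = 1.
    by rewrite /h -(rmorph_nat (@polyC R) 2) -polyCM mulVf ?pnatr_eq0.
  (* The derivative of T E = 1, multiplied by t T, gives t T' + T^2 (t E') = 0; replacing t E' and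
     then T E eliminates [E]. The witness collects the remainders [r], [s] and r' met on the way. *)
  exists (T * (r^`() * 'X + r * N%:R - T * s)
          - T * ('X * r) + T * r - 'X * T^`() * r).
  rewrite /H derivD derivZ derivX -!mul_polyC -/h mulr1.
  rewrite (_ : (4^-1)%:P = h ^+ 2); last first.
    by rewrite /h expr2 -polyCM; congr (_%:P); field.
  apply/eqP; rewrite -subr_eq0; apply/eqP.
  have a0 : T * E - 1 - r * 'X^N = 0 by rewrite rE subrr.
  have b0 : 'X * E^`() - ('X * E + 1 - E) - s * 'X^N = 0 by rewrite sE subrr.
  have c0 : T^`() * E + T * E^`() - (r^`() * 'X^N + r * (N%:R * 'X^n)) = 0.
    by rewrite dr subrr.
  have d0 : 'X * 'X^n - 'X^N = 0 :> {poly R} by rewrite XN subrr.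
  transitivity ((h * 2 - 1) * (T * 'X)
     + 'X * T * (T^`() * E + T * E^`() - (r^`() * 'X^N + r * (N%:R * 'X^n)))
     - ('X * T^`() + 'X * T - T) * (T * E - 1 - r * 'X^N)
     - T ^+ 2 * ('X * E^`() - ('X * E + 1 - E) - s * 'X^N)
     + T * N%:R * r * ('X * 'X^n - 'X^N)); last first.
    by rewrite a0 b0 c0 d0 h2 subrr; ring.
  move: T^`() E^`() r^`() ('X^N) ('X^n) (N%:R) => T' E' r' Y Z NN.
  by ring.
have coefH i : (i < N)%N -> H`_i = hnum i.
  by move=> iN; rewrite coefD coefT// coefZ coefX /hnum mulrC.
have := congr1 (fun p : {poly R} => p`_n) qE.
rewrite coefMXn ltnS leqnn => /eqP.
rewrite coefB subr_eq0 coefD coefB coefZ coefXn coefXM expr2 coefM coefH//.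
rewrite (eq_bigr (fun k : 'I_n.+1 => hnum k * hnum (n - k))); last first.
  by move=> k _; rewrite !coefH// ltnS leq_subr.
move=> /eqP/esym e; rewrite [X in _ + X]mulrC e.
case: eqVneq => [n0|n0]; first by rewrite [in LHS]n0 mul0r.
by rewrite coef_deriv prednK ?lt0n// coefH// mulr_natl.
Qed.
End BernoulliAlgebra.

(** * A Riccati comparison with the cotangent *)

Section RealLemmas.
Variable R : realType.

Lemma is_derive_le (f df : R -> R) (a b : R) : a <= b ->
  (forall x : R, a <= x <= b -> is_derive x 1 f (df x)) ->
  (forall x, a <= x <= b -> 0 <= df x) -> f a <= f b.
Proof.
move=> ab fdf df0.
have cf : {within `[a, b], continuous f}.
  apply: derivable_within_continuous => x; rewrite in_itv /= => xab.
  by case: (fdf _ xab).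
have fdf' x : x \in `]a, b[ -> is_derive x 1 f (df x).
  by rewrite in_itv /= => /andP[xa xb]; apply: fdf; rewrite !ltW.
have [c cab e] := MVT_segment ab fdf' cf.
move: cab; rewrite in_itv /= => cab.
by rewrite -subr_ge0 e mulr_ge0 ?df0// subr_ge0.
Qed.

Lemma is_derive_half (f df : R -> R) (x : R) :
  (forall y : R, is_derive y 1 f (df y)) ->
  is_derive x 1 (fun y => f (y / 2)) (df (x / 2) / 2).
Proof.
move=> fdf.
have d2 : is_derive x 1 (fun y : R => y / 2) 2^-1.
  have := @is_deriveZ R R R id 2^-1 x 1 1 (is_derive_id x (1 : R)).
  rewrite (_ : 2^-1 *: 1 = 2^-1 :> R); last by rewrite /GRing.scale /= mulr1.
  rewrite (_ : 2^-1 \*: id = fun y : R => y / 2)//.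
  by apply/funext => y /=; rewrite /GRing.scale /= mulrC.
exact: is_derive1_comp.
Qed.

Lemma horner_coef_ge0 (q : {poly R}) (x : R) :
  (forall i, 0 <= q`_i) -> 0 <= x -> 0 <= q.[x].
Proof.
move=> q0 x0; rewrite horner_coef; apply: sumr_ge0 => i _.
by rewrite mulr_ge0 ?exprn_ge0.
Qed.

Lemma horner_coef_le (q : {poly R}) (x y : R) :
  (forall i, 0 <= q`_i) -> 0 <= x -> x <= y -> q.[x] <= q.[y].
Proof.
move=> q0 x0 xy; rewrite !horner_coef; apply: ler_sum => i _.
by rewrite ler_wpM2l// lerXn2r// nnegrE// (le_trans x0).
Qed.

Definition cotw (x : R) : R := 1 - x / 2 * (cos (x / 2) / sin (x / 2)).

Lemma sin_half_gt0 (x : R) : 0 < x < 2 * pi -> 0 < sin (x / 2).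
Proof.
move=> /andP[x0 xpi]; apply: sin_gt0_pi; apply/andP; split; first lra.
by rewrite ltr_pdivrMr// mulrC.
Qed.

Lemma is_derive_cotw (x : R) : 0 < x < 2 * pi ->
  is_derive x 1 (fun y => y * cotw y) (x ^+ 2 / 4 + cotw x ^+ 2).
Proof.
move=> x2pi; have s0 := lt0r_neq0 (sin_half_gt0 x2pi).
have dc : is_derive x 1 (fun y : R => cos (y / 2)) (- sin (x / 2) / 2).
  exact: (is_derive_half x (@is_derive_cos R)).
have ds : is_derive x 1 (fun y : R => sin (y / 2)) (cos (x / 2) / 2).
  exact: (is_derive_half x (@is_derive_sin R)).
have dx : is_derive x 1 (fun y : R => y / 2) 2^-1.
  have := @is_derive_half id (fun=> 1) x (fun y => is_derive_id y (1 : R)).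
  by rewrite mul1r.
have dv := is_deriveV s0 ds.
have dq := is_deriveM dc dv.
have dp := is_deriveM dx dq.
have dw := is_deriveB (is_derive_cst (1 : R) x (1 : R)) dp.
have dd := is_deriveM (is_derive_id x (1 : R)) dw.
apply: (is_derive_eq dd).
rewrite !fctE /cotw /GRing.scale /=.
move: s0; move: (sin (x / 2)) (cos (x / 2)) => s c s0.
by field.
Qed.

(** Serves as the initial condition near 0 in the comparison. It holds because sin z - z cos z
    vanishes at 0 and has derivative z sin z. *)
Lemma cotw_ge0 (x : R) : 0 < x <= 1 -> 0 <= cotw x.
Proof.
move=> /andP[x0 x1]; have pi2 := pi_ge2 R.
have s0 : 0 < sin (x / 2) by apply: sin_half_gt0; apply/andP; split; lra.
suff : x / 2 * cos (x / 2) <= sin (x / 2).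
  by rewrite /cotw subr_ge0 mulrA ler_pdivrMr// mul1r.
have dF (y : R) : is_derive y 1 (fun z => sin z - z * cos z) (y * sin y).
  have := is_deriveB (is_derive_sin y)
    (is_deriveM (is_derive_id y (1 : R)) (is_derive_cos y)).
  move=> /is_derive_eq; apply; rewrite /GRing.scale /=; ring.
have := @is_derive_le (fun z => sin z - z * cos z) (fun y => y * sin y) 0 (x / 2).
rewrite sin0 mul0r subr0 subr_ge0; apply => //; first lra.
move=> y /andP[y0 yx]; rewrite mulr_ge0// sin_ge0_pi//.
by apply/andP; split; lra.
Qed.

(** The hypothesis compares the derivatives of x p(x) and x w(x), so x (w(x) - p(x)) is
    nondecreasing on (0, 2 pi). The quotient in [cotw] has no meaningful value at 0, so the start of
    the comparison is a small positive point instead. *)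
Lemma riccati_comparison (p : {poly R}) : (forall i, 0 <= p`_i) ->
  (forall x, 0 < x < 2 * pi ->
     ('X * p)^`().[x] <= x ^+ 2 / 4 + cotw x ^+ 2) ->
  forall x, 0 < x < 2 * pi -> p.[x] <= cotw x.
Proof.
move=> p0 dp x /[dup] x2pi /andP[x0 xpi].
pose u (y : R) := y * cotw y - ('X * p).[y].
have du (y : R) : 0 < y < 2 * pi ->
    is_derive y 1 u (y ^+ 2 / 4 + cotw y ^+ 2 - ('X * p)^`().[y]).
  move=> y2pi; exact: is_deriveB (is_derive_cotw y2pi) (is_derive_poly _ _).
have uE y : u y = y * (cotw y - p.[y]) by rewrite /u hornerM hornerX [RHS]mulrBr.
suff : 0 <= u x by rewrite uE pmulr_rge0// subr_ge0.
rewrite leNgt; apply/negP => ux0.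
have C0 : 0 <= p.[1] by apply: horner_coef_ge0.
(* At [e] the function [u] is at least - e p(1), because [cotw] is nonnegative and p(e) <= p(1). The
   third bound on [e] makes this strictly larger than u(x) and contradicts monotonicity; the summand
   1 keeps the denominator positive. *)
pose e := Num.min x (Num.min 1 (- u x / (2 * (p.[1] + 1)))).
have C2 : 0 < 2 * (p.[1] + 1) by lra.
have e0 : 0 < e by rewrite !lt_min x0 ltr01 /= divr_gt0// oppr_gt0.
have ex : e <= x by rewrite ge_min lexx.
have e1 : e <= 1 by rewrite !ge_min lexx orbT.
have eC : e * (2 * (p.[1] + 1)) <= - u x.
  by rewrite -ler_pdivlMr// !ge_min lexx !orbT.
have : u e <= u x.
  apply: (@is_derive_le u
    (fun y => y ^+ 2 / 4 + cotw y ^+ 2 - ('X * p)^`().[y]) e x ex) =>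
    y /andP[ey yx].
    by apply: du; rewrite (lt_le_trans e0)//= (le_lt_trans yx).
  by rewrite subr_ge0 dp// (lt_le_trans e0)//= (le_lt_trans yx).
apply/negP; rewrite -ltNge (uE e).
have w0 : 0 <= cotw e by apply: cotw_ge0; rewrite e0.
have pe : p.[e] <= p.[1] by apply: horner_coef_le => //; exact: ltW.
have : e * (cotw e - p.[e]) >= - (e * p.[1]).
  by rewrite -mulrN ler_wpM2l ?(ltW e0)//; lra.
apply: lt_le_trans; move: eC; rewrite mulrDr mulr1 mulrDr => eC.
have : 0 <= e * p.[1] by rewrite mulr_ge0 ?(ltW e0).
nra.
Qed.

End RealLemmas.

(** * Absolute convergence of the Bernoulli series for radii below 2 pi *)

Section BernoulliMajorant.
Variable R : realType.
Local Notation hnum := (hnum R).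
Local Notation bnum := (bnum R).
Local Notation nbern := (nbern R).

(** The value 0 at index 0 stands for H - 1: the two products containing h_0 = 1 are moved to the
    left of the recursion and turn its factor n into n + 1. *)
Let gam (k : nat) : R := if k is 0 then 0 else `|hnum k|.

Lemma bnum0 : bnum 0 = 1.
Proof. by rewrite /bnum nbern0 hornerC. Qed.

Let gam_ge0 k : 0 <= gam k. Proof. by case: k => /=. Qed.

Let gam_rec n :
  n.+1%:R * gam n <= (n == 2%N)%:R / 4 + \sum_(k < n.+1) gam k * gam (n - k).
Proof.
case: n => [|m]; first by rewrite big_ord_recl big_ord0 /= !mulr0 mul0r !addr0.
have h0 : hnum 0 = 1 by rewrite /hnum bnum0 mul0r addr0.
have := hnum_riccati R m.+1.
rewrite big_ord_recl big_ord_recr /= subn0 h0 mul1r.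
have bm : (m.+1 - bump 0 m = 0)%N by rewrite /bump /= add1n subnn.
have bm1 : bump 0 m = m.+1 by rewrite /bump leq0n add1n.
rewrite bm1 subnn h0 mulr1 => e.
have {}e : m.+2%:R * hnum m.+1 = (m.+1 == 2%N)%:R / 4 -
    \sum_(i < m) hnum (bump 0 i) * hnum (m.+1 - bump 0 i).
  by move: e; rewrite -[m.+2%:R]natr1 mulrDl => ->; ring.
rewrite -[X in X * _]normr_nat -normrM e (le_trans (ler_normB _ _))//.
rewrite ger0_norm; last by rewrite divr_ge0.
rewrite lerD2l (le_trans (ler_norm_sum _ _ _))//.
rewrite big_ord_recl big_ord_recr /= mul0r add0r.
rewrite bm mulr0 addr0; apply: ler_sum => i _; rewrite normrM.
rewrite /bump /= !add1n subSS; case: (m - i)%N (subn_gt0 i m) => //=.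
by rewrite ltn_ord.
Qed.

Let pgam N := \poly_(i < N) gam i.

(** As gam 0 = 0, the nonzero products in the recursion at an index at most N have both indices
    below N. So the derivative of x times the truncation at N + 1 is at most x^2/4 plus the square
    of the truncation at N, which the induction hypothesis bounds by the square of [cotw]. *)
Let pgam_le_cotw N (x : R) : 0 < x < 2 * pi -> (pgam N).[x] <= cotw x.
Proof.
elim: N x => [|N IHN] x.
  move: x; apply: riccati_comparison => [i|x _].
    by rewrite coef_poly.
  rewrite /pgam poly_def big_ord0 mulr0 deriv0 horner0 addr_ge0// ?sqr_ge0//.
  by rewrite divr_ge0 ?sqr_ge0.
have p0 M i : 0 <= (pgam M)`_i by rewrite coef_poly; case: ifP.
move: x; apply: riccati_comparison => // x /[dup] x2pi /andP[x0 _].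
have px : 0 <= (pgam N).[x] by apply: horner_coef_ge0 => //; exact: ltW.
apply: (@le_trans _ _ (x ^+ 2 / 4 + (pgam N).[x] ^+ 2)); last first.
  by rewrite lerD2l lerXn2r ?nnegrE// ?IHN// (le_trans px)// IHN.
rewrite -subr_ge0.
rewrite (_ : _ - _ = (4^-1 *: 'X^2 + pgam N ^+ 2 - ('X * pgam N.+1)^`()).[x]).
  apply: horner_coef_ge0; last exact: ltW.
  move=> i; rewrite coefB coefD coef_deriv coefXM /= coefZ coefXn expr2 coefM.
  rewrite subr_ge0 coef_poly; case: ifP => [iN|_]; last first.
    rewrite mul0rn addr_ge0 ?mulr_ge0//.
    by apply: sumr_ge0 => k _; rewrite mulr_ge0.
  rewrite -[gam i *+ _]mulr_natl (le_trans (gam_rec i))// mulrC lerD2l.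
  apply: ler_sum => k _.
  rewrite !coef_poly; case: ifP => [_|]; last first.
    move=> /negbT; rewrite -leqNgt => Nk.
    have -> : (i - k = 0)%N.
      by apply/eqP; rewrite subn_eq0 (leq_trans _ Nk)// -ltnS.
    by rewrite mulr0 mul0r.
  case: ifP => // /negbT; rewrite -leqNgt => Nk.
  have -> : (k = 0 :> nat)%N; last by rewrite /= !mul0r.
  by move: iN Nk; have := ltn_ord k; lia.
by rewrite hornerD hornerN hornerD hornerZ !horner_exp hornerX [4^-1 * _]mulrC.
Qed.

Lemma bnum_bounded (s : R) : 0 <= s < 2 * pi ->
  exists M, forall N, \sum_(k < N) `|bnum k| * s ^+ k <= M.
Proof.
move=> /andP[s0 spi].
(* The comparison lives on the open interval and [s] may be 0; the midpoint of s and 2 pi lies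
   inside and is at least [s]. *)
pose x := (s + 2 * pi) / 2.
have x2pi : 0 < x < 2 * pi by rewrite /x; apply/andP; split; lra.
have sx : s <= x by rewrite /x; lra.
have x0 : 0 <= x by rewrite (le_trans s0).
(* The 1 accounts for b_0, which [gam] omits, and the x for the term t/2 separating b_1 from h_1. *)
exists (cotw x + (1 + x)) => N.
pose q : {poly R} := 1 + 'X.
pose a := \poly_(k < N) `|bnum k|.
have -> : \sum_(k < N) `|bnum k| * s ^+ k = a.[s].
  by rewrite /a horner_poly.
have a0 i : 0 <= a`_i by rewrite coef_poly; case: ifP.
apply: (@le_trans _ _ a.[x]); first exact: horner_coef_le.
rewrite -[1 + x](_ : q.[x] = _); last by rewrite !hornerE.
apply: le_trans (lerD (pgam_le_cotw N x2pi) (lexx _)).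
rewrite -subr_ge0 -hornerD -hornerN -hornerD; apply: horner_coef_ge0 => // i.
rewrite coefB coefD !coef_poly coefD coefX coef1 subr_ge0.
case: ifP => [iN|_]; last by rewrite add0r addr_ge0.
case: i iN => [|i] iN; first by rewrite bnum0 normr1 /= add0r addr0.
rewrite /= add0r.
have -> : bnum i.+1 = hnum i.+1 - (i.+1 == 1%N)%:R / 2 by rewrite /hnum addrK.
rewrite (le_trans (ler_normB _ _))// lerD2l ger0_norm ?divr_ge0//.
by rewrite ler_pdivrMr// ler_peMr// ler1n.
Qed.

Lemma coef_nbern k i :
  (nbern k)`_i = if (i <= k)%N then bnum (k - i) / i`!%:R else 0.
Proof.
elim: i k => [|i IHi] k.
  by rewrite leq0n subn0 fact0 divr1 /bnum horner_coef0.
case: k => [|k]; first by rewrite nbern0 coef1.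
rewrite ltnS subSS; have := IHi k; rewrite -nbern_deriv coef_deriv => e.
have : (nbern k.+1)`_i.+1 * i.+1%:R = if (i <= k)%N then bnum (k - i) / i`!%:R else 0.
  by rewrite mulr_natr.
have i0 : i.+1%:R != 0 :> R by rewrite pnatr_eq0.
move=> /(canRL (mulfK i0)) ->.
case: ifP => _; last by rewrite mul0r.
by rewrite factS natrM invfM mulrA mulrAC.
Qed.

(** The coefficient of t^k in (sum_j |b_j| t^j) e^t: a bound for b_k(x) on [0, 1] obtained by
    expanding in powers of x, and summable since it is a Cauchy product. *)
Definition mbern (k : nat) : R := \sum_(i < k.+1) `|bnum (k - i)| / i`!%:R.

Lemma mbern_ge0 k : 0 <= mbern k.
Proof. by apply: sumr_ge0 => i _; rewrite divr_ge0. Qed.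

Lemma horner_nbern k (u : R) :
  (nbern k).[u] = \sum_(i < k.+1) bnum (k - i) / i`!%:R * u ^+ i.
Proof.
rewrite (@horner_coef_wide _ k.+1).
  by apply: eq_bigr => i _; rewrite coef_nbern -ltnS ltn_ord.
by apply/leq_sizeP => j kj; rewrite coef_nbern leqNgt kj.
Qed.

Lemma nbern_le k (u : R) : 0 <= u <= 1 -> `|(nbern k).[u]| <= mbern k.
Proof.
move=> /andP[u0 u1]; rewrite horner_nbern (le_trans (ler_norm_sum _ _ _))//.
apply: ler_sum => i _; rewrite !normrM normfV normr_nat normrX (ger0_norm u0).
by rewrite ler_piMr ?exprn_ile1// divr_ge0.
Qed.

Lemma nbern1 k : (nbern k.+1).[1] = (nbern k.+1).[0] + (k == 0%N)%:R.
Proof.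
rewrite horner_nbern big_ord_recl /= subn0 fact0 divr1 expr0 mulr1.
congr (_ + _); rewrite -(bnum_conv R k).
rewrite (reindex_inj rev_ord_inj) /=; apply: eq_bigr => i _.
by rewrite expr1n mulr1 /bump /= add1n subSS subKn ?subnSK//  -ltnS.
Qed.

Lemma mbern_bounded (s : R) : 0 <= s < 2 * pi ->
  exists M, forall N, \sum_(k < N) mbern k * s ^+ k <= M.
Proof.
move=> /[dup] /andP[s0 _] /bnum_bounded[M bM].
exists (M * expR s) => N.
pose a := \poly_(k < N) `|bnum k|.
pose b := \poly_(k < N) (k`!%:R^-1 : R).
have a0 i : 0 <= a`_i by rewrite coef_poly; case: ifP.
have b0 i : 0 <= b`_i by rewrite coef_poly; case: ifP.
have aM : a.[s] <= M by rewrite horner_poly.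
have bE : b.[s] <= expR s.
  rewrite horner_poly (_ : \sum_(i < N) _ = series (exp_coeff s) N).
    apply: (@nondecreasing_cvgn_le _ (series (exp_coeff s))); last exact: is_cvg_series_exp_coeff.
    apply: nondecreasing_series => n _ _.
    by rewrite /exp_coeff /= divr_ge0 ?exprn_ge0.
  rewrite /series /= big_mkord; apply: eq_bigr => i _.
  by rewrite /exp_coeff /= mulrC.
(* With nonnegative coefficients, the truncated Cauchy product is dominated coefficientwise by the
   product of the truncations. *)
have := ler_pM (horner_coef_ge0 a0 s0) (horner_coef_ge0 b0 s0) aM bE.
apply: le_trans; rewrite -hornerM -(horner_poly N mbern) -subr_ge0 -hornerN -hornerD.
apply: horner_coef_ge0 => // i; rewrite coefB subr_ge0 coef_poly.
case: ifP => [iN|_]; last first.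
  by rewrite coefM; apply: sumr_ge0 => j _; rewrite mulr_ge0.
rewrite coefMr; apply: ler_sum => j _.
have ji : (j <= i)%N by rewrite -ltnS.
by rewrite !coef_poly !(leq_ltn_trans _ iN)// ?leq_subr.
Qed.

End BernoulliMajorant.

(** * Complex exponential and the generating function of the Bernoulli polynomials *)

Notation normc := ComplexField.Normc.normc.

Section ComplexNorm.
Variable R : realType.
Implicit Types z w : R[i].

Lemma normc_norm z : `|z| = (normc z)%:C. Proof. by []. Qed.

Lemma normc_ge0 z : 0 <= normc z.
Proof. by case: z => a b; exact: sqrtr_ge0. Qed.

Lemma normcD z w : normc (z + w) <= normc z + normc w.
Proof. exact: (@le_normcD R). Qed.

Lemma normc_sum (I : Type) (r : seq I) (P : pred I) (F : I -> R[i]) :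
  normc (\sum_(i <- r | P i) F i) <= \sum_(i <- r | P i) normc (F i).
Proof.
elim/big_ind2 : _ => // [|x1 x2 y1 y2 h1 h2].
  by rewrite ComplexField.Normc.normc0.
by rewrite (le_trans (normcD _ _))// lerD.
Qed.

Lemma normc_prod (I : Type) (r : seq I) (P : pred I) (F : I -> R[i]) :
  normc (\prod_(i <- r | P i) F i) = \prod_(i <- r | P i) normc (F i).
Proof.
exact: (big_morph _ (@ComplexField.Normc.normcM R) (@ComplexField.Normc.normc1 R)).
Qed.

Lemma normcX z n : normc (z ^+ n) = normc z ^+ n.
Proof.
elim: n => [|n IHn]; first by rewrite !expr0 ComplexField.Normc.normc1.
by rewrite !exprS ComplexField.Normc.normcM IHn.
Qed.

Lemma normc_real (x : R) : normc x%:C = `|x|.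
Proof. by rewrite /= expr0n addr0 sqrtr_sqr. Qed.

Lemma normc_distC z w : normc (z - w) = normc (w - z).
Proof. by rewrite -[LHS](@normcN R) opprB. Qed.

Lemma Re_le_normc z : `|complex.Re z| <= normc z.
Proof. by case: z => a b /=; rewrite -sqrtr_sqr ler_wsqrtr// lerDl sqr_ge0. Qed.

Lemma Im_le_normc z : `|complex.Im z| <= normc z.
Proof. by case: z => a b /=; rewrite -sqrtr_sqr ler_wsqrtr// lerDr sqr_ge0. Qed.

Lemma normc_le_ReIm z : normc z <= `|complex.Re z| + `|complex.Im z|.
Proof.
case: z => a b; rewrite (_ : a +i* b = a%:C + (0 +i* b)).
  by rewrite (le_trans (normcD _ _))// normc_real /= expr0n add0r sqrtr_sqr !addr0 add0r.
by apply/eqP; rewrite eq_complex /= addr0 add0r !eqxx.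
Qed.

(** The norm of [R[i]] has values in [R[i]] itself; this passes to the real modulus and real
    tolerances, in which all estimates are made. *)
Lemma cvg_normcP (T : Type) (F : set_system T) {FF : Filter F}
    (f : T -> R[i]^o) (l : R[i]^o) :
  (f @ F --> l) <->
  (forall e : R, 0 < e -> \forall x \near F, normc (l - f x) <= e).
Proof.
split=> [/cvgrPdist_le fl e e0|fl].
  have : 0 < e%:C :> R[i] by rewrite ltcR.
  by move=> /fl; apply: filterS => x; rewrite normc_norm lecR.
apply/cvgrPdist_le => e e0.
have eE : e = (complex.Re e)%:C by rewrite RRe_real// gtr0_real.
have : 0 < complex.Re e by rewrite -ltcR -eE.
by move=> /fl; apply: filterS => x; rewrite normc_norm [in X in _ -> X]eE lecR.
Qed.

Lemma cexpD z w : cexp (z + w) = cexp z * cexp w.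
Proof.
case: z w => a b [c d]; rewrite /cexp /= expRD cosD sinD.
apply/eqP; rewrite eq_complex /=; apply/andP; split; apply/eqP; ring.
Qed.

Lemma cexp0 : cexp 0 = 1 :> R[i].
Proof.
rewrite /cexp /= expR0 cos0 sin0.
by apply/eqP; rewrite eq_complex /= !mulr0 !mul0r mulr1 subr0 addr0 !eqxx.
Qed.

Lemma cexpN z : cexp z * cexp (- z) = 1.
Proof. by rewrite -cexpD subrr cexp0. Qed.

Lemma cexp_sum (I : Type) (r : seq I) (P : pred I) (F : I -> R[i]) :
  cexp (\sum_(i <- r | P i) F i) = \prod_(i <- r | P i) cexp (F i).
Proof. exact: (big_morph _ cexpD cexp0). Qed.

Lemma normc_cexp z : normc (cexp z) = expR (complex.Re z).
Proof.
rewrite /cexp ComplexField.Normc.normcM normc_real /= cos2Dsin2 sqrtr1 mulr1.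
by rewrite ger0_norm// expR_ge0.
Qed.

End ComplexNorm.

(** * Complex-valued functions of a real variable *)

Section ComplexDerivative.
Variable R : realType.
Implicit Types (f g : R -> R[i]) (u : R).

(** Componentwise, so that the real mean value theorem can be applied to each component. *)
Definition is_cderive f u (d : R[i]) :=
  is_derive u 1 (fun x => complex.Re (f x)) (complex.Re d) /\
  is_derive u 1 (fun x => complex.Im (f x)) (complex.Im d).

Lemma is_cderiveM f g u df dg : is_cderive f u df -> is_cderive g u dg ->
  is_cderive (fun x => f x * g x) u (f u * dg + df * g u).
Proof.
move=> [f1 f2] [g1 g2]; split.
- rewrite (_ : (fun x => _) = (fun x => complex.Re (f x)) * (fun x => complex.Re (g x)) -
      (fun x => complex.Im (f x)) *
      (fun x => complex.Im (g x))); last first.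
    by apply/funext => x; rewrite !fctE; case: (f x) (g x) => a b [c d].
  apply: (is_derive_eq (is_deriveB (is_deriveM f1 g1) (is_deriveM f2 g2))).
  rewrite /GRing.scale /=; case: (f u) (g u) df dg {f1 f2 g1 g2} => a b [c d] [a' b'] [c' d'] /=.
  ring.
- rewrite (_ : (fun x => _) = (fun x => complex.Re (f x)) * (fun x => complex.Im (g x)) +
      (fun x => complex.Im (f x)) *
      (fun x => complex.Re (g x))); last first.
    by apply/funext => x; rewrite !fctE; case: (f x) (g x) => a b [c d].
  apply: (is_derive_eq (is_deriveD (is_deriveM f1 g2) (is_deriveM f2 g1))).
  rewrite /GRing.scale /=; case: (f u) (g u) df dg {f1 f2 g1 g2} => a b [c d] [a' b'] [c' d'] /=.
  ring.
Qed.

Lemma is_cderiveD f g u df dg : is_cderive f u df -> is_cderive g u dg ->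
  is_cderive (fun x => f x + g x) u (df + dg).
Proof.
move=> [f1 f2] [g1 g2]; split.
- rewrite (_ : (fun x => _) = (fun x => complex.Re (f x)) +
      (fun x => complex.Re (g x))); last first.
    by apply/funext => x; rewrite !fctE; case: (f x) (g x) => a b [c d].
  by apply: (is_derive_eq (is_deriveD f1 g1)); case: df dg {f1 f2 g1 g2} => a b [c d].
- rewrite (_ : (fun x => _) = (fun x => complex.Im (f x)) +
      (fun x => complex.Im (g x))); last first.
    by apply/funext => x; rewrite !fctE; case: (f x) (g x) => a b [c d].
  by apply: (is_derive_eq (is_deriveD f2 g2)); case: df dg {f1 f2 g1 g2} => a b [c d].
Qed.

Lemma is_cderive_sum n (h : 'I_n -> R -> R[i]) u (dh : 'I_n -> R[i]) :
  (forall i, is_cderive (h i) u (dh i)) ->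
  is_cderive (fun x => \sum_(i < n) h i x) u (\sum_(i < n) dh i).
Proof.
elim: n h dh => [|n IHn] h dh hd.
  rewrite big_ord0; split.
    rewrite (_ : (fun x => _) = cst 0); first exact: is_derive_cst.
    by apply/funext => x; rewrite big_ord0.
  rewrite (_ : (fun x => _) = cst 0); first exact: is_derive_cst.
  by apply/funext => x; rewrite big_ord0.
rewrite big_ord_recr (_ : (fun x => _) =
    fun x => \sum_(i < n) h (widen_ord (leqnSn n) i) x + h ord_max x).
  by apply: is_cderiveD => //; apply: IHn => i.
by apply/funext => x; rewrite big_ord_recr.
Qed.

Lemma is_cderive_poly (c : R[i]) (p : {poly R}) u :
  is_cderive (fun x => c * p.[x]%:C) u (c * p^`().[u]%:C).
Proof.
case: c => a b.
have dp k : is_derive u 1 (fun x => k * p.[x]) (k * p^`().[u]).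
  by have := is_deriveZ k (is_derive_poly p u); exact.
split.
- rewrite (_ : (fun x => _) = (fun x => a * p.[x])); last first.
    by apply/funext => x /=; rewrite mulr0 subr0.
  by rewrite /= mulr0 subr0.
- rewrite (_ : (fun x => _) = (fun x => b * p.[x])); last first.
    by apply/funext => x /=; rewrite mulr0 add0r.
  by rewrite /= mulr0 add0r.
Qed.

Lemma is_derive_scale (f df : R -> R) (a u : R) :
  (forall y : R, is_derive y 1 f (df y)) ->
  is_derive u 1 (fun y => f (a * y)) (df (a * u) * a).
Proof.
move=> fdf.
have da : is_derive u 1 (fun y : R => a * y) a.
  have := is_deriveZ a (is_derive_id u (1 : R)).
  by rewrite /GRing.scale /= mulr1.
exact: is_derive1_comp.
Qed.

Lemma is_cderive_cexp (z : R[i]) u :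
  is_cderive (fun x => cexp (z * x%:C)) u (z * cexp (z * u%:C)).
Proof.
case: z => a b.
have de := is_derive_scale a u (@is_derive_expR R).
have dc := is_derive_scale b u (@is_derive_cos R).
have ds := is_derive_scale b u (@is_derive_sin R).
split.
- rewrite (_ : (fun x => _) = (fun x => expR (a * x)) * (fun x => cos (b * x))); last first.
    by apply/funext => x; rewrite !fctE /cexp /= !mulr0 mul0r !subr0 add0r.
  apply: (is_derive_eq (is_deriveM de dc)).
  by rewrite /GRing.scale /cexp /= !mulr0 !mul0r !subr0 !add0r; ring.
- rewrite (_ : (fun x => _) = (fun x => expR (a * x)) * (fun x => sin (b * x))); last first.
    by apply/funext => x; rewrite !fctE /cexp /= !mulr0 mul0r !subr0 addr0 add0r.
  apply: (is_derive_eq (is_deriveM de ds)).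
  by rewrite /GRing.scale /cexp /= !mulr0 !mul0r !subr0 !add0r !addr0; ring.
Qed.

(** The intermediate points for the real and imaginary parts differ, so the mean value theorem is
    used once for each; hence the bound B + B. *)
Lemma is_cderive_le f (df : R -> R[i]) (B u : R) : 0 <= u <= 1 ->
  (forall x, 0 <= x <= 1 -> is_cderive f x (df x)) ->
  (forall x, 0 <= x <= 1 -> normc (df x) <= B) ->
  normc (f u - f 0) <= B + B.
Proof.
move=> /andP[u0 u1] fdf dfB.
have in01 x : x \in `[0, u] -> 0 <= x <= 1.
  by rewrite in_itv /= => /andP[-> xu]; rewrite (le_trans xu).
have mvt (h dh : R -> R) : (forall x : R, 0 <= x <= 1 -> is_derive x 1 h (dh x)) ->
    (forall x : R, 0 <= x <= 1 -> `|dh x| <= B) -> `|h u - h 0| <= B.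
  move=> hdh dhB.
  have ch : {within `[0, u], continuous h}.
    by apply: derivable_within_continuous => x /in01/hdh[].
  have hdh' x : x \in `]0, u[ -> is_derive x 1 h (dh x).
    by move=> xu; apply/hdh/in01; exact: subset_itv_oo_cc.
  have [c /in01 cu ->] := MVT_segment u0 hdh' ch.
  rewrite subr0 normrM (ger0_norm u0) (le_trans _ (dhB c cu))//.
  by rewrite ler_piMr.
rewrite (le_trans (normc_le_ReIm _))//; apply: lerD.
- have := mvt (fun x => complex.Re (f x)) (fun x => complex.Re (df x)).
  rewrite (_ : complex.Re (f u - f 0) = complex.Re (f u) - complex.Re (f 0)).
    apply=> x x01; first by case: (fdf _ x01).
    by rewrite (le_trans (Re_le_normc _))// dfB.
  by case: (f u) (f 0) => a b [].
- have := mvt (fun x => complex.Im (f x)) (fun x => complex.Im (df x)).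
  rewrite (_ : complex.Im (f u - f 0) = complex.Im (f u) - complex.Im (f 0)).
    apply=> x x01; first by case: (fdf _ x01).
    by rewrite (le_trans (Im_le_normc _))// dfB.
  by case: (f u) (f 0) => a b [].
Qed.

End ComplexDerivative.

Lemma cvg_affine (K : numFieldType) (T : Type) (F : set_system T)
    {FF : Filter F} (f g : T -> K^o) (a b c d : K^o) :
  f @ F --> a -> g @ F --> b ->
  (fun x => (f x + g x - c) * d) @ F --> (a + b - c) * d.
Proof.
move=> fa gb; apply: cvgMl.
by apply: cvgB; [exact: cvgD|exact: cvg_cst].
Qed.

(** * Summation of the Bernoulli generating series *)

Section BernoulliGenerating.
Variable R : realType.
Variable t : R[i].
Hypothesis t2pi : normc t < 2 * pi.

Let g N (u : R) : R[i] := \sum_(k < N) t ^+ k * ((nbern R k).[u])%:C.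

Let e N := mbern R N * normc t ^+ N.

Let e_cvg0 : e @ \oo --> 0.
Proof.
have [|M bM] := @mbern_bounded R (normc t).
  by rewrite normc_ge0 t2pi.
apply: cvg_series_cvg_0; apply: nondecreasing_is_cvgn.
  apply: nondecreasing_series => n _ _.
  by rewrite mulr_ge0 ?mbern_ge0// exprn_ge0// normc_ge0.
by exists M => _ [N _ <-]; rewrite /series /= big_mkord.
Qed.

Let D N (u : R) := g N.+1 u * cexp (- t * u%:C) - g N.+1 0.

Let D_le N u : 0 <= u <= 1 ->
  normc (D N u) <= e N * (normc t * expR (normc t)) * 2.
Proof.
move=> u01.
pose F (x : R) : R[i] := g N.+1 x * cexp (- t * x%:C).
pose dF (x : R) : R[i] := - t * (t ^+ N * ((nbern R N).[x])%:C) * cexp (- t * x%:C).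
have dg (x : R) : is_cderive (g N.+1) x (t * g N x).
  have := @is_cderive_sum R N.+1 (fun k y => t ^+ k * ((nbern R k).[y])%:C) x
    (fun k => t ^+ k * ((nbern R k)^`().[x])%:C) (fun k => is_cderive_poly _ _ _).
  rewrite big_ord_recl nbern0 -[1]polyC1 derivC horner0 mulr0 add0r.
  rewrite (_ : \sum_(i < N) _ = t * g N x)// /g mulr_sumr.
  by apply: eq_bigr => i _; rewrite lift0 nbern_deriv exprS mulrA.
have dFP x : is_cderive F x (dF x).
  have := is_cderiveM (dg x) (is_cderive_cexp (- t) x).
  rewrite (_ : _ + _ = dF x)// /dF /g big_ord_recr /=.
  ring.
have := @is_cderive_le R F dF (e N * (normc t * expR (normc t))) u u01
  (fun x _ => dFP x).
rewrite /F mulr0 cexp0 mulr1 -mulr2n mulr_natr; apply=> x x01.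
rewrite /dF ComplexField.Normc.normcM normc_cexp !ComplexField.Normc.normcM.
rewrite (@normcN R) normcX normc_real.
rewrite /e [leRHS](_ : _ =
  normc t * (normc t ^+ N * mbern R N) * expR (normc t)); last by ring.
apply: ler_pM; rewrite ?expR_ge0 ?mulr_ge0 ?normc_ge0 ?exprn_ge0 ?normc_ge0//.
  by rewrite !ler_wpM2l ?exprn_ge0 ?normc_ge0// nbern_le.
rewrite ler_expR (_ : complex.Re _ = - (complex.Re t) * x); last first.
  by case: t => a b /=; rewrite mulr0 subr0.
rewrite (le_trans (ler_norm _))// normrM normrN.
case/andP: x01 => x0 x1; rewrite (ger0_norm x0).
by rewrite (le_trans _ (Re_le_normc _))// ler_piMr.
Qed.

Let D_cvg0 u : 0 <= u <= 1 -> (fun N => D N u : R[i]^o) @ \oo --> (0 : R[i]^o).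
Proof.
move=> u01; apply/cvg_normcP => eps eps0.
pose K := normc t * expR (normc t) * 2.
have K0 : 0 <= K by rewrite !mulr_ge0 ?normc_ge0 ?expR_ge0.
have : (fun N => e N * K) @ \oo --> 0 * K by apply: cvgMl.
rewrite mul0r => /cvgrPdist_le/(_ _ eps0); apply: filterS => N.
rewrite sub0r normrN => h; rewrite sub0r (@normcN R).
by rewrite (le_trans (D_le N u01))// (le_trans _ h)// -mulrA ler_norm.
Qed.

Let g1 N : g N.+2 1 = g N.+2 0 + t.
Proof.
rewrite /g !big_ord_recl !lift0 /= !expr0 expr1 !nbern1 !nbern0 !hornerC /=.
rewrite rmorphD /= mulrDr mulr1 -!addrA; congr (_ + (_ + _)).
rewrite addrC; congr (_ + _); last by rewrite rmorph1 mulr1.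
apply: eq_bigr => i _.
by rewrite (_ : bump 0 (bump 0 i) = i.+2)// nbern1 addr0.
Qed.

(** At u = 1, where g_N(1) - g_N(0) = t, the limit D_N(1) -> 0 is a linear equation for the limit of
    g_N(0), with solution [todd t]. Any other u then follows from D_N(u) -> 0. *)
Lemma bernoulli_generating (u : R) : 0 <= u <= 1 ->
  (fun N => \sum_(k < N) t ^+ k * ((nbern R k).[u])%:C : R[i]^o) @ \oo -->
  (todd t * cexp (t * u%:C) : R[i]^o).
Proof.
move=> u01; rewrite -/g -[X in X @ _]/(fun N => g N u : R[i]^o).
have g0 : (fun N => g N.+2 0 : R[i]^o) @ \oo --> (todd t : R[i]^o).
  have D1 : (fun N => D N.+1 1 : R[i]^o) @ \oo --> (0 : R[i]^o).
    by rewrite (cvg_shiftS (fun N => D N 1 : R[i]^o)); apply: D_cvg0; rewrite ler01 lexx.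
  have DE N : D N.+1 1 = g N.+2 0 * (cexp (- t) - 1) + t * cexp (- t).
    by rewrite /D g1 mulr1; ring.
  rewrite /todd; case: eqP => [t0|/eqP t0].
    rewrite (_ : (fun N => _) = cst 1); first exact: cvg_cst.
    apply/funext => N; rewrite /g big_ord_recl big1 => [|i _].
      by rewrite expr0 nbern0 hornerC mulr1 addr0.
    by rewrite t0 lift0 expr0n mul0r.
  (* If e^(-t) were 1, the sequence D_N(1) would be constantly t while tending to 0. So the
     convergence itself shows that e^t - 1 has no zero but 0 in the disc. *)
  have et : cexp (- t) - 1 != 0.
    apply: contra_neq t0 => e1.
    have : (fun N => D N.+1 1 : R[i]^o) = cst t.
      apply/funext => N; rewrite DE e1 mulr0 add0r /=.
      by move/eqP : e1; rewrite subr_eq0 => /eqP ->; rewrite mulr1.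
    move=> De; move: D1; rewrite De => tc.
    have := cvg_unique (@norm_hausdorff _ R[i]^o) tc (cvg_cst (t : R[i]^o)).
    by move=> ->.
  rewrite (_ : (fun N => _) =
      fun N => (D N.+1 1 + 0 - t * cexp (- t)) * (cexp (- t) - 1)^-1 : R[i]^o); last first.
    by apply/funext => N; rewrite DE addr0 addrK mulfK.
  rewrite (_ : t / _ = (0 + 0 - t * cexp (- t)) * (cexp (- t) - 1)^-1); last first.
    rewrite addr0 sub0r; have eN : cexp t != 0.
      by apply/eqP => e0; have := cexpN t; rewrite e0 mul0r => /esym/eqP; rewrite oner_eq0.
    have e2 : cexp (- t) = (cexp t)^-1.
      by apply: (mulfI eN); rewrite cexpN mulfV.
    move: et; rewrite e2 => et.
    have et1 : cexp t - 1 != 0.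
      by apply: contra_neq et => /eqP; rewrite subr_eq0 => /eqP ->; rewrite invr1 subrr.
    have eE : cexp t - 1 = ((cexp t)^-1 - 1) * - cexp t.
      by rewrite mulrN mulrBl mulVf// mul1r opprB.
    by apply: (mulIf et1); rewrite divfK// [in RHS]eE mulrA divfK// mulrNN divfK.
  exact: (@cvg_affine R[i] nat \oo _ (fun N => D N.+1 1) (fun=> 0) 0 0
    (t * cexp (- t)) (cexp (- t) - 1)^-1 D1 (cvg_cst _)).
rewrite -(cvg_shiftS (fun N => g N u : R[i]^o)) -(cvg_shiftS (fun N => g N.+1 u : R[i]^o)).
rewrite (_ : (fun N => _) =
    fun N => (g N.+2 0 + D N.+1 u - 0) * cexp (t * u%:C)); last first.
  apply/funext => N; rewrite subr0 /D addrC subrK -mulrA [cexp _ * _]mulrC mulNr.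
  by rewrite cexpN mulr1.
rewrite (_ : todd t * _ = (todd t + 0 - 0) * cexp (t * u%:C)); last first.
  by rewrite addr0 subr0.
have D0 : (fun N => D N.+1 u : R[i]^o) @ \oo --> (0 : R[i]^o).
  by rewrite (cvg_shiftS (fun N => D N u : R[i]^o)); exact: D_cvg0.
exact: (@cvg_affine R[i] nat \oo _ (fun N => g N.+2 0) (fun N => D N.+1 u)
  (todd t) 0 0 (cexp (t * u%:C)) g0 D0).
Qed.

End BernoulliGenerating.

(** * Iterated integrals over the unit cube *)

Section CoordinateMeasurability.
Variables (R : realType) (I : finType).

Definition fpt := {ffun I -> R^o}.
HB.instance Definition _ := Choice.on fpt.
HB.instance Definition _ := isPointed.Build fpt [ffun=> 0].

(** Generators of the product sigma-algebra. It makes [upd] jointly measurable in the point and the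
    new coordinate, which is what Tonelli needs at each stage of an iterated integral. *)
Definition cylinders : set (set fpt) :=
  [set A | exists i, exists2 B : set R, measurable B & A = [set x : fpt | B (x i)]].

Definition mpt := g_sigma_algebraType cylinders.
HB.instance Definition _ := Measurable.on mpt.

Lemma measurable_coord (i : I) : measurable_fun setT (fun x : mpt => x i : R).
Proof.
move=> _ B mB; rewrite setTI; apply: sub_sigma_algebra.
by exists i, B.
Qed.

Lemma measurable_upd (i : I) :
  measurable_fun setT (fun z : mpt * R => upd z.1 i z.2 : mpt).
Proof.
apply: (@measurability _ _ _ mpt setT _ cylinders) => //.
move=> _ [_ [j [B mB ->]] <-]; rewrite setTI.
case: (eqVneq j i) => [->|ji].
  rewrite (_ : _ @^-1` _ = (snd : mpt * R -> R) @^-1` B).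
    by rewrite -[X in measurable X]setTI; exact: measurable_snd.
  by apply/seteqP; split=> z /=; rewrite ffunE eqxx.
rewrite (_ : _ @^-1` _ = (fst : mpt * R -> mpt) @^-1` [set x : mpt | B (x j)]).
  rewrite -[X in measurable X]setTI; apply: measurable_fst => //.
  by apply: sub_sigma_algebra; exists j, B.
by apply/seteqP; split=> z /=; rewrite ffunE (negbTE ji).
Qed.

Definition meas (f : fpt -> R) := measurable_fun setT (f : mpt -> R).

Local Notation mu := (@lebesgue_measure R).
Local Notation itv01 := (`[0%R, 1%R]%classic : set R).

Lemma meas_upd2 (f : fpt -> R) (i : I) : meas f ->
  measurable_fun setT (fun z : mpt * R => f (upd z.1 i z.2)).
Proof.
move=> mf; exact: (measurableT_comp (f := (f : mpt -> R)) mf (measurable_upd i)).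
Qed.

Lemma meas_section (f : fpt -> R) (i : I) (x : fpt) : meas f ->
  measurable_fun setT (fun u : R => f (upd x i u)).
Proof.
move=> mf; exact: (measurableT_comp (meas_upd2 i mf) (measurable_pair1 (x : mpt))).
Qed.

(** Tonelli treats the positive and the negative part separately, after a cut-off by the indicator
    of [0, 1]; the real integral is [fine] of their difference. *)
Lemma meas_int (f : fpt -> R) (i : I) : meas f ->
  meas (fun x => \int[mu]_(u in itv01) f (upd x i u)).
Proof.
move=> mf.
have m01 : measurable itv01 by exact: measurable_itv.
have key (h : mpt * R -> \bar R) : measurable_fun setT h -> (forall z, 0 <= h z)%E ->
    measurable_fun setT (fun x : mpt => \int[mu]_u h (x, u))%E.
  by move=> mh h0; exact: (@measurable_fun_fubini_tonelli_F _ _ _ _ _ mu h mh h0).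
pose h (z : mpt * R) : \bar R := ((f (upd z.1 i z.2) * \1_itv01 z.2)%:E).
have mh : measurable_fun setT h.
  apply/measurable_EFinP; apply: measurable_funM; first exact: meas_upd2.
  by apply: measurableT_comp; [exact: measurable_indic|exact: measurable_snd].
rewrite /meas (_ : (fun x => _) = fine \o (fun x : mpt =>
   (\int[mu]_u (h^\+ (x, u))) - (\int[mu]_u (h^\- (x, u)))))%E.
  apply: measurableT_comp; first exact: fine_measurable.
  by apply: emeasurable_funB; apply: key => //;
    [exact: measurable_funepos|exact: measurable_funeneg].
apply/funext => x; rewrite /Rintegral /=; congr fine.
rewrite integral_mkcond integralE; congr (_ - _)%E; apply: eq_integral => u _.
- rewrite !funeposE /h /patch /= indicE mem_setE.
  by case: ifP => _; rewrite ?mulr1 ?mulr0.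
- rewrite !funenegE /h /patch /= indicE mem_setE.
  by case: ifP => _; rewrite ?mulr1 ?mulr0.
Qed.

End CoordinateMeasurability.

(** * Bounded measurable integrands and negligible hyperplanes *)

Section CubeIntegrals.
Variables (R : realType) (I : finType).
Local Notation pt := {ffun I -> R^o}.
Local Notation mu := (@lebesgue_measure R).
Local Notation itv01 := (`[0%R, 1%R]%classic : set R).
Implicit Types (f g h : pt -> R) (s : seq I).

Definition cube : set pt := [set x : pt | forall i, 0 <= (x i : R) <= 1].

(** A class stable under integrating out one coordinate over [0, 1]. The bound is restricted to the
    cube because coordinates and linear forms are unbounded elsewhere. *)
Definition nice f := meas f /\ exists M, forall x, cube x -> `|f x| <= M.

Lemma cube0 : cube 0.
Proof. by move=> i; rewrite ffunE lexx ler01. Qed.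

Lemma upd_cube x i (u : R) : cube x -> 0 <= u <= 1 -> cube (upd x i u).
Proof. by move=> cx u01 j; rewrite ffunE; case: eqP. Qed.

Lemma nice_cst (c : R) : nice (fun=> c).
Proof. by split; [exact: measurable_cst|exists `|c|]. Qed.

Lemma niceD f g : nice f -> nice g -> nice (fun x => f x + g x).
Proof.
move=> [mf [M fM]] [mg [N gN]]; split; first exact: measurable_funD.
exists (M + N) => x cx; rewrite (le_trans (ler_normD _ _))//.
by rewrite lerD ?fM ?gN.
Qed.

Lemma niceM f g : nice f -> nice g -> nice (fun x => f x * g x).
Proof.
move=> [mf [M fM]] [mg [N gN]]; split; first exact: measurable_funM.
by exists (M * N) => x cx; rewrite normrM ler_pM ?fM ?gN.
Qed.

Lemma niceN f : nice f -> nice (fun x => - f x).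
Proof.
move=> nf; rewrite (_ : (fun _ => _) = fun x => (-1) * f x).
  by apply: niceM => //; exact: nice_cst.
by apply/funext => x; rewrite mulN1r.
Qed.

Lemma niceB f g : nice f -> nice g -> nice (fun x => f x - g x).
Proof. by move=> nf ng; apply: niceD => //; exact: niceN. Qed.

Lemma nice_sum (J : Type) (r : seq J) (F : J -> pt -> R) :
  (forall j, nice (F j)) -> nice (fun x => \sum_(j <- r) F j x).
Proof.
move=> nF; elim: r => [|j r IHr].
  by under eq_fun do rewrite big_nil; exact: nice_cst.
by under eq_fun do rewrite big_cons; exact: niceD.
Qed.

Lemma nice_prod (J : Type) (r : seq J) (F : J -> pt -> R) :
  (forall j, nice (F j)) -> nice (fun x => \prod_(j <- r) F j x).
Proof.
move=> nF; elim: r => [|j r IHr].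
  by under eq_fun do rewrite big_nil; exact: nice_cst.
by under eq_fun do rewrite big_cons; exact: niceM.
Qed.

Lemma nice_coord (i : I) : nice (fun x => x i : R).
Proof.
split; first exact: measurable_coord.
by exists 1 => x cx; have /andP[x0 x1] := cx i; rewrite ger0_norm.
Qed.

Lemma nice_comp (phi : R -> R) f : measurable_fun setT phi -> meas f ->
  (exists M, forall x, cube x -> `|phi (f x)| <= M) -> nice (fun x => phi (f x)).
Proof. by move=> mphi mf bf; split=> //; exact: (measurableT_comp mphi mf). Qed.

Lemma nice_expR f : nice f -> nice (fun x => expR (f x)).
Proof.
move=> [mf [M fM]]; apply: nice_comp => //.
exists (expR M) => x cx; rewrite ger0_norm ?expR_ge0// ler_expR.
by rewrite (le_trans (ler_norm _))// fM.
Qed.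

Lemma nice_cos f : nice f -> nice (fun x => cos (f x)).
Proof.
move=> [mf _]; apply: nice_comp => //.
  by apply: continuous_measurable_fun; exact: continuous_cos.
by exists 1 => x _; exact: cos_max.
Qed.

Lemma nice_sin f : nice f -> nice (fun x => sin (f x)).
Proof.
move=> [mf _]; apply: nice_comp => //.
  by apply: continuous_measurable_fun; exact: continuous_sin.
by exists 1 => x _; exact: sin_max.
Qed.

Lemma nice_horner (p : {poly R}) f : nice f -> nice (fun x => p.[f x]).
Proof.
move=> nf; rewrite (_ : (fun x => _) = fun x => \sum_(i < size p) p`_i * \prod_(j < i) f x).
  apply: nice_sum => i; apply: niceM; first exact: nice_cst.
  by apply: nice_prod.
by apply/funext => x; rewrite horner_coef; apply: eq_bigr => i _; rewrite prodr_const card_ord.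
Qed.

Lemma nice_indic (A : set pt) : measurable (A : set (mpt R I)) ->
  nice (fun x => (x \in A)%:R).
Proof.
move=> mA; split; last by exists 1 => x _; case: (x \in A); rewrite ?normr1 ?normr0.
exact: (@measurable_indic _ (mpt R I) R setT A).
Qed.

Lemma measurable_le_cst f (c : R) : meas f ->
  measurable ([set x | f x <= c] : set (mpt R I)).
Proof.
move=> mf; rewrite (_ : [set x | _] = (setT `&` f @^-1` `]-oo, c])%classic).
  by apply: mf => //; exact: measurable_itv.
by rewrite setTI; apply/seteqP; split=> x /=; rewrite in_itv.
Qed.

Lemma measurable_ge_cst f (c : R) : meas f ->
  measurable ([set x | c <= f x] : set (mpt R I)).
Proof.
move=> mf; rewrite (_ : [set x | _] = (setT `&` f @^-1` `[c, +oo[)%classic).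
  by apply: mf => //; exact: measurable_itv.
by rewrite setTI; apply/seteqP; split=> x /=; rewrite in_itv /= andbT.
Qed.

Lemma measurable_eq_cst f (c : R) : meas f ->
  measurable ([set x | f x = c] : set (mpt R I)).
Proof.
move=> mf; rewrite (_ : [set x | _] = (setT `&` f @^-1` [set c])%classic).
  by apply: mf => //; exact: measurable_set1.
by rewrite setTI; apply/seteqP; split.
Qed.

Let mu01 : mu itv01 = 1%E.
Proof. by rewrite lebesgue_measure_itv /= lte_fin ltr01 oppr0 adde0. Qed.

Let Rint01_cst (c : R) : \int[mu]_(u in itv01) c = c.
Proof.
rewrite Rintegral_cst; last exact: measurable_itv.
rewrite [X in fine X](_ : _ = 1%E) ?mulr1//; exact: mu01.
Qed.

Lemma nice_integrable f i x : nice f -> cube x ->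
  mu.-integrable itv01 (EFin \o (fun u => f (upd x i u))).
Proof.
move=> [mf [M fM]] cx; apply: measurable_bounded_integrable => //.
- by rewrite [ltLHS]mu01 ltry.
- by apply: measurable_funTS; exact: meas_section.
- exists M; split; first exact: num_real.
  move=> N MN u /= u01; rewrite (le_trans _ (ltW MN))// fM//.
  by apply: upd_cube => //; move: u01; rewrite in_itv.
Qed.

Lemma nice_step f i : nice f -> nice (fun x => \int[mu]_(u in itv01) f (upd x i u)).
Proof.
move=> nf; have [mf [M fM]] := nf; split; first exact: meas_int.
exists M => x cx; rewrite (le_trans (le_normr_Rintegral _ (nice_integrable i nf cx)))//.
rewrite -[leRHS]Rint01_cst.
apply: le_Rintegral => //.
- have nf' : nice (fun x => `|f x|).
    split; first exact: measurableT_comp.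
    by exists M => z cz; rewrite normr_id fM.
  exact: (nice_integrable i nf').
- exact: (nice_integrable i (nice_cst M) cx).
- by move=> u u01; apply/fM/upd_cube => //; move: u01; rewrite /= in_itv.
Qed.

Lemma nice_iint_seq f s : nice f -> nice (iint_seq itv01 f s).
Proof. by move=> nf; elim: s => //= i s IHs; exact: nice_step. Qed.

Lemma eq_iint_seq f g s x : cube x -> (forall z, cube z -> f z = g z) ->
  iint_seq itv01 f s x = iint_seq itv01 g s x.
Proof.
move=> + fg; elim: s x => [|i s IHs] x cx /=; first exact: fg.
apply: eq_Rintegral => u; rewrite inE /= in_itv => u01.
by apply/IHs/upd_cube.
Qed.

Lemma iint_seq_lin (c : R) f g s x : nice f -> nice g -> cube x ->
  iint_seq itv01 (fun z => c * f z + g z) s x =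
  c * iint_seq itv01 f s x + iint_seq itv01 g s x.
Proof.
move=> nf ng; elim: s x => //= i s IHs x cx.
under eq_Rintegral.
  move=> u; rewrite inE /= in_itv => u01.
  rewrite IHs; last exact: upd_cube.
  over.
have nf' := nice_iint_seq s nf; have ng' := nice_iint_seq s ng.
rewrite RintegralD//; last 2 first.
- exact: (nice_integrable i (niceM (nice_cst c) nf') cx).
- exact: (nice_integrable i ng' cx).
by rewrite RintegralZl//; exact: (nice_integrable i nf' cx).
Qed.

Lemma le_iint_seq f g s x : nice f -> nice g -> cube x ->
  (forall z, cube z -> f z <= g z) -> iint_seq itv01 f s x <= iint_seq itv01 g s x.
Proof.
move=> nf ng + fg; elim: s x => [|i s IHs] x cx /=; first exact: fg.
apply: le_Rintegral => //.
- exact: (nice_integrable i (nice_iint_seq s nf) cx).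
- exact: (nice_integrable i (nice_iint_seq s ng) cx).
- by move=> u /=; rewrite in_itv => u01; apply/IHs/upd_cube.
Qed.

Lemma iint_seq_cst (c : R) s x : iint_seq itv01 (fun=> c) s x = c.
Proof.
elim: s x => //= i s IHs x; under eq_Rintegral do rewrite IHs.
by rewrite Rint01_cst.
Qed.

Lemma norm_iint_seq_le f h s x : nice f -> nice h -> cube x ->
  (forall z, cube z -> `|f z| <= h z) ->
  `|iint_seq itv01 f s x| <= iint_seq itv01 h s x.
Proof.
move=> nf nh cx fh; rewrite ler_norml; apply/andP; split; last first.
  by apply: le_iint_seq => // z cz; rewrite (le_trans (ler_norm _))// fh.
have := @iint_seq_lin (-1) h (fun=> 0) s x nh (nice_cst 0) cx.
rewrite iint_seq_cst addr0 mulN1r => <-.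
apply: le_iint_seq => //; first exact: niceD (niceM (nice_cst _) nh) (nice_cst 0).
by move=> z cz; rewrite addr0 mulN1r lerNl (le_trans _ (fh _ cz))// -normrN ler_norm.
Qed.

Definition hyperplane (c : I -> R) (d : R) : set pt :=
  [set x : pt | \sum_i c i * (x i : R) = d].

Lemma measurable_hyperplane c d : measurable (hyperplane c d : set (mpt R I)).
Proof.
apply: measurable_eq_cst.
have [] // : nice (fun x : pt => \sum_i c i * (x i : R)).
by apply: nice_sum => i; apply: niceM; [exact: nice_cst|exact: nice_coord].
Qed.

Let sum_upd (c : I -> R) (x : pt) i (u : R) :
  \sum_j c j * (upd x i u j : R) = c i * u + \sum_(j | j != i) c j * (x j : R).
Proof.
rewrite (bigD1 i)//= ffunE eqxx; congr (_ + _).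
by apply: eq_bigr => j ji; rewrite ffunE (negbTE ji).
Qed.

(* The integral over the last coordinate [i] in [s] with [c i != 0] already
   vanishes: the later integrations do not see the hyperplane. *)
Lemma iint_seq_hyperplane c d s x :
  iint_seq itv01 (fun z => (z \in hyperplane c d)%:R) s x =
  if has (fun i => c i != 0) s then 0 else (x \in hyperplane c d)%:R.
Proof.
elim: s x => //= i s IHs x; under eq_Rintegral do rewrite IHs.
case: (has _ s); first by rewrite orbT Rint01_cst.
rewrite orbF; case: eqP => [ci0|/eqP ci0] /=.
  under eq_Rintegral => u _.
    rewrite (_ : (upd x i u \in _) = (x \in hyperplane c d)).
      over.
    have eqs : \sum_j c j * (upd x i u j : R) = \sum_j c j * (x j : R).
      by rewrite sum_upd [RHS](bigD1 i)//= ci0 !mul0r.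
    by apply/idP/idP; rewrite !inE /hyperplane /= eqs.
  by rewrite Rint01_cst.
pose u0 := (d - \sum_(j | j != i) c j * (x j : R)) / c i.
transitivity (\int[mu]_(u in itv01) ((fun _ : R => (1 : R)) \_ [set u0]) u).
  apply: eq_Rintegral => u _; rewrite /patch.
  rewrite (_ : (u \in [set u0]) = (upd x i u \in hyperplane c d)); first by case: ifP.
  apply/idP/idP; rewrite !inE /hyperplane /= sum_upd.
    by move=> ->; rewrite mulrC divfK// subrK.
  by move=> e; rewrite /u0 -e addrK mulrC mulKf.
rewrite -Rintegral_mkcondr Rintegral_cst; last exact: measurableI.
rewrite [X in fine X](_ : _ = 0%E) /= ?mulr0//.
apply/eqP; rewrite eq_le measure_ge0 andbT.
rewrite -[leRHS](lebesgue_measure_set1 u0); apply: le_measure; rewrite ?inE//.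
exact: measurableI.
Qed.

(** On the cube |f| is at most M times the sum of the indicators of the hyperplanes. This pointwise
    domination replaces an almost-everywhere argument and suits iterated integrals. *)
Lemma iint_null (K : finType) (c : K -> I -> R) (d : K -> R) f :
  (forall k, exists i, c k i != 0) -> nice f ->
  (forall x, cube x -> f x != 0 -> exists k, hyperplane (c k) (d k) x) ->
  iint itv01 f = 0.
Proof.
move=> ck nf f0; have [_ [M fM]] := nf.
pose h (x : pt) := \sum_k (x \in hyperplane (c k) (d k))%:R : R.
have n1 k : nice (fun x : pt => (x \in hyperplane (c k) (d k))%:R).
  by apply: nice_indic; exact: measurable_hyperplane.
have nh : nice h by apply: nice_sum.
have ih : iint_seq itv01 h (enum I) 0 = 0.
  rewrite /h; elim: (index_enum K) => [|k ks IHk].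
    by under [X in iint_seq _ X]eq_fun do rewrite big_nil; exact: iint_seq_cst.
  under [X in iint_seq _ X]eq_fun do rewrite big_cons -[X in X + _]mul1r.
  rewrite iint_seq_lin ?IHk ?addr0 ?mul1r//; last 2 first.
  - by apply: nice_sum.
  - exact: cube0.
  rewrite iint_seq_hyperplane ifT//; apply/hasP.
  by have [i ci] := ck k; exists i => //; rewrite mem_enum.
have := @norm_iint_seq_le f (fun x => M * h x + 0) (enum I) 0 nf
  (niceD (niceM (nice_cst M) nh) (nice_cst 0)) cube0.
rewrite iint_seq_lin// ?ih ?iint_seq_cst ?mulr0 ?addr0; last 2 first.
- exact: nice_cst.
- exact: cube0.
move=> H; apply/eqP; rewrite -normr_le0; apply: H => z cz.
have hz0 : 0 <= h z by apply: sumr_ge0.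
have [->|fz] := eqVneq (f z) 0.
  by rewrite normr0 addr0 mulr_ge0// (le_trans _ (fM _ cube0)).
have [k zk] := f0 _ cz fz.
rewrite addr0 (le_trans (fM _ cz))// ler_peMr//.
  by rewrite (le_trans _ (fM _ cz)).
by rewrite /h (bigD1 k)//= mem_set// lerDl sumr_ge0.
Qed.

Lemma iint_seq_outside (D : set R) f s (x : pt) :
  (exists2 i, i \notin s & ~ D (x i)) ->
  (forall z : pt, (exists i, ~ D (z i)) -> f z = 0) ->
  iint_seq setT f s x = 0.
Proof.
move=> xD f0; elim: s x xD => [|j s IHs] x /=.
  by case=> i _ Dx; apply: f0; exists i.
case=> i; rewrite inE negb_or => /andP[ij si] Dx.
under eq_Rintegral => u _.
  rewrite IHs; first over.
  by exists i => //; rewrite ffunE (negbTE ij).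
by rewrite Rintegral_cst// mul0r.
Qed.

(** Once a coordinate is set outside [D], no later integration changes it, since [s] has no
    repetitions; so the inner integrals vanish there and each integral shrinks to [D]. *)
Lemma iint_setT (D : set R) f s x : uniq s ->
  (forall z : pt, (exists i, ~ D (z i)) -> f z = 0) ->
  iint_seq setT f s x = iint_seq D f s x.
Proof.
move=> + f0; elim: s x => //= i s IHs x /andP[is_ us].
rewrite [RHS]Rintegral_mkcond; apply: eq_Rintegral => u _; rewrite /patch.
case: ifPn => uD; first exact: IHs.
apply: (@iint_seq_outside D) => //; exists i => //.
by rewrite ffunE eqxx; move/negP: uD; rewrite inE.
Qed.

End CubeIntegrals.

Section ComplexCubeIntegrals.
Variables (R : realType) (I : finType).
Local Notation pt := {ffun I -> R^o}.
Local Notation itv01 := (`[0%R, 1%R]%classic : set R).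
Implicit Types (f g : pt -> R[i]).

Definition cnice f :=
  nice (fun x => complex.Re (f x)) /\ nice (fun x => complex.Im (f x)).

Lemma cnice_cst (c : R[i]) : cnice (fun=> c).
Proof. by split; exact: nice_cst. Qed.

Lemma cnice_real (f : pt -> R) : nice f -> cnice (fun x => (f x)%:C).
Proof. by move=> nf; split => //; exact: nice_cst. Qed.

Lemma cniceD f g : cnice f -> cnice g -> cnice (fun x => f x + g x).
Proof.
move=> [f1 f2] [g1 g2]; split.
- rewrite (_ : (fun x => _) = fun x => complex.Re (f x) + complex.Re (g x)).
    exact: niceD.
  by apply/funext => x; case: (f x) (g x) => a b [].
- rewrite (_ : (fun x => _) = fun x => complex.Im (f x) + complex.Im (g x)).
    exact: niceD.
  by apply/funext => x; case: (f x) (g x) => a b [].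
Qed.

Lemma cniceM f g : cnice f -> cnice g -> cnice (fun x => f x * g x).
Proof.
move=> [f1 f2] [g1 g2]; split.
- rewrite (_ : (fun x => _) = fun x => complex.Re (f x) * complex.Re (g x) -
      complex.Im (f x) * complex.Im (g x)).
    by apply: niceB; exact: niceM.
  by apply/funext => x; case: (f x) (g x) => a b [].
- rewrite (_ : (fun x => _) = fun x => complex.Re (f x) * complex.Im (g x) +
      complex.Im (f x) * complex.Re (g x)).
    by apply: niceD; exact: niceM.
  by apply/funext => x; case: (f x) (g x) => a b [].
Qed.

Lemma cniceB f g : cnice f -> cnice g -> cnice (fun x => f x - g x).
Proof.
move=> nf ng; rewrite (_ : (fun x => _) = fun x => f x + (-1) * g x).
  by apply: cniceD => //; apply: cniceM => //; exact: cnice_cst.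
by apply/funext => x; rewrite mulN1r.
Qed.

Lemma cnice_sum (J : Type) (s : seq J) (F : J -> pt -> R[i]) :
  (forall j, cnice (F j)) -> cnice (fun x => \sum_(j <- s) F j x).
Proof.
move=> nF; elim: s => [|j s IHs].
  by under eq_fun do rewrite big_nil; exact: cnice_cst.
by under eq_fun do rewrite big_cons; exact: cniceD.
Qed.

Lemma cnice_prod (J : Type) (s : seq J) (F : J -> pt -> R[i]) :
  (forall j, cnice (F j)) -> cnice (fun x => \prod_(j <- s) F j x).
Proof.
move=> nF; elim: s => [|j s IHs].
  by under eq_fun do rewrite big_nil; exact: cnice_cst.
by under eq_fun do rewrite big_cons; exact: cniceM.
Qed.

Lemma cnice_cexp f : cnice f -> cnice (fun x => cexp (f x)).
Proof.
move=> [f1 f2]; split.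
- rewrite (_ : (fun x => _) =
      fun x => expR (complex.Re (f x)) * cos (complex.Im (f x))).
    by apply: niceM; [exact: nice_expR|exact: nice_cos].
  by apply/funext => x; rewrite /cexp /= mul0r subr0.
- rewrite (_ : (fun x => _) =
      fun x => expR (complex.Re (f x)) * sin (complex.Im (f x))).
    by apply: niceM; [exact: nice_expR|exact: nice_sin].
  by apply/funext => x; rewrite /cexp /= mul0r addr0.
Qed.

Lemma cnice_if (A : set pt) f : measurable (A : set (mpt R I)) -> cnice f ->
  cnice (fun x => if x \in A then f x else 0).
Proof.
move=> mA nf; rewrite (_ : (fun x => _) = fun x => ((x \in A)%:R : R)%:C * f x).
  by apply: cniceM => //; apply: cnice_real; exact: nice_indic.
apply/funext => x; case: (x \in A); first by rewrite rmorph1 mul1r.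
by rewrite rmorph0 mul0r.
Qed.

Lemma eq_cint_cube f g : (forall x, cube x -> f x = g x) ->
  cint_cube f = cint_cube g.
Proof.
move=> fg; rewrite /cint_cube /ciint /iint.
by congr (_ +i* _); apply: eq_iint_seq; try exact: cube0; move=> z cz; rewrite fg.
Qed.

Lemma cint_cube_lin (c : R[i]) f g : cnice f -> cnice g ->
  cint_cube (fun x => c * f x + g x) = c * cint_cube f + cint_cube g.
Proof.
case: c => a b [f1 f2] [g1 g2]; rewrite /cint_cube /ciint /iint.
have -> : (fun x => complex.Re ((a +i* b) * f x + g x)) =
    (fun x => a * complex.Re (f x) + ((- b) * complex.Im (f x) + complex.Re (g x))).
  apply/funext => x; case: (f x) (g x) => p q [u v] /=; ring.
have -> : (fun x => complex.Im ((a +i* b) * f x + g x)) =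
    (fun x => a * complex.Im (f x) + (b * complex.Re (f x) + complex.Im (g x))).
  apply/funext => x; case: (f x) (g x) => p q [u v] /=; ring.
have n c h k : nice h -> nice k -> nice (fun x : pt => c * h x + k x).
  by move=> nh nk; apply: niceD => //; apply: niceM => //; exact: nice_cst.
have c0 := @cube0 R I.
rewrite !iint_seq_lin//; try exact: n.
by apply/eqP; rewrite eq_complex /=; apply/andP; split; apply/eqP; ring.
Qed.

Lemma cint_cube_cst0 : cint_cube (fun _ : pt => 0 : R[i]) = 0.
Proof. by rewrite /cint_cube /ciint /iint /= !iint_seq_cst. Qed.

Lemma cint_cubeZ (c : R[i]) f : cnice f ->
  cint_cube (fun x => c * f x) = c * cint_cube f.
Proof.
move=> nf; have := cint_cube_lin c nf (cnice_cst 0).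
by rewrite cint_cube_cst0 addr0; under [X in cint_cube X]eq_fun do rewrite addr0.
Qed.

Lemma cint_cube_sum (J : Type) (s : seq J) (c : J -> R[i]) (F : J -> pt -> R[i]) :
  (forall j, cnice (F j)) ->
  cint_cube (fun x => \sum_(j <- s) c j * F j x) =
  \sum_(j <- s) c j * cint_cube (F j).
Proof.
move=> nF; elim: s => [|j s IHs].
  rewrite big_nil -[RHS]cint_cube_cst0; congr cint_cube.
  by apply/funext => x; rewrite big_nil.
rewrite big_cons -IHs -cint_cube_lin//; last first.
  by apply: cnice_sum => k; apply: cniceM => //; exact: cnice_cst.
by congr cint_cube; apply/funext => x; rewrite big_cons.
Qed.

Lemma cint_cube_dist_le f g (e : R) : cnice f -> cnice g ->
  (forall x, cube x -> normc (f x - g x) <= e) ->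
  normc (cint_cube f - cint_cube g) <= e + e.
Proof.
move=> nf ng fg; have := cint_cube_lin (-1) ng nf.
rewrite mulN1r [- _ + _]addrC => <-.
have [n1 n2] : cnice (fun x => -1 * g x + f x).
  by apply: cniceD => //; apply: cniceM => //; exact: cnice_cst.
have fg' x : cube x -> normc (-1 * g x + f x) <= e.
  by rewrite mulN1r addrC; exact: fg.
have nE := nice_cst I e; have c0 := @cube0 R I.
rewrite (le_trans (normc_le_ReIm _))// /cint_cube /ciint /iint /=; apply: lerD.
  rewrite -[leRHS](iint_seq_cst e (enum I) 0).
  apply: norm_iint_seq_le => // x cx.
  by rewrite (le_trans (Re_le_normc _))// fg'.
rewrite -[leRHS](iint_seq_cst e (enum I) 0).
apply: norm_iint_seq_le => // x cx.
by rewrite (le_trans (Im_le_normc _))// fg'.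
Qed.

Lemma cint_cube_null (K : finType) (c : K -> I -> R) (d : K -> R) f :
  (forall k, exists i, c k i != 0) -> cnice f ->
  (forall x, cube x -> f x != 0 -> exists k, hyperplane (c k) (d k) x) ->
  cint_cube f = 0.
Proof.
move=> ck [f1 f2] f0; rewrite /cint_cube /ciint.
have hR : iint itv01 (fun x => complex.Re (f x)) = 0.
  apply: (iint_null ck f1) => x cx fx; apply: f0 => //.
  by apply: contraNneq fx => ->.
have hI : iint itv01 (fun x => complex.Im (f x)) = 0.
  apply: (iint_null ck f2) => x cx fx; apply: f0 => //.
  by apply: contraNneq fx => ->.
by rewrite hR hI.
Qed.

Lemma cint_over_cube (P : set pt) f : (P `<=` @cube R I)%classic ->
  cint_over P f = cint_cube (fun x => if x \in P then f x else 0).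
Proof.
move=> Pc; rewrite /cint_over /cint_cube /ciint /iint.
have out (h : R[i] -> R) : h 0 = 0 -> forall z : pt,
    (exists i, ~ itv01 (z i)) -> h (if z \in P then f z else 0) = 0.
  move=> h0 z [i zi]; case: ifPn => // zP; exfalso; apply: zi.
  by rewrite /= in_itv; apply: Pc; rewrite inE in zP.
congr (_ +i* _); apply: iint_setT; try exact: enum_uniq; exact: out.
Qed.

End ComplexCubeIntegrals.

(** * Bounded polyhedra are polytopes *)

Section BoundedPolyhedra.
Variables (R : realType) (E : lmodType R) (J : finType).
Variables (a : J -> E -> R) (b : J -> R).
Hypothesis aP : forall j (c : R) x y, a j (c *: x + y) = c * a j x + a j y.

Let P : set E := [set x | forall j, a j x <= b j].

Let tight (x : E) : {set J} := [set j | a j x == b j].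

Let vertex (x : E) :=
  P x /\ forall d, (forall j, j \in tight x -> a j d = 0) -> d = 0.

Let a0 j : a j 0 = 0.
Proof. by have := aP j (-1) 0 0; rewrite scaler0 addr0 mulN1r addNr. Qed.

Let aZ j c x : a j (c *: x) = c * a j x.
Proof. by rewrite -[c *: x]addr0 aP a0 addr0. Qed.

Let aD j x y : a j (x + y) = a j x + a j y.
Proof. by rewrite -[x]scale1r aP mul1r scale1r. Qed.

(** A vertex is determined by its set of tight constraints: the difference of two vertices with the
    same set lies in the common kernel, which is 0. *)
Let finite_vertex : finite_set (vertex : set E).
Proof.
pose g (T : {set J}) : E := xget 0 [set x | vertex x /\ tight x = T].
apply: (@sub_finite_set _ _ (g @` [set: {set J}])); last first.
  by apply: finite_image; exact: finite_finset.
move=> x vx; exists (tight x) => //.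
rewrite /g; case: xgetP => [y _ [[Py vy] yx]|/(_ x)]; last by case.
apply/eqP; rewrite -subr_eq0; apply/eqP; apply: vy => j jy.
have jx : j \in tight x by rewrite -yx.
move: jx jy; rewrite !inE => /eqP jx /eqP jy.
by rewrite -scaleN1r addrC aP jx jy mulN1r addNr.
Qed.

(** Triviality of the recession cone, that is, boundedness of [P] when it is nonempty. *)
Hypothesis bounded : forall d, d != 0 -> exists j, 0 < a j d.

(** A ratio test: the least quotient [q j] over the constraints growing along [d] is the largest
    admissible step. Its minimiser becomes tight, and the old tight constraints stay tight since [d]
    is in their kernel. *)
Let ray x d : P x -> d != 0 -> (forall j, j \in tight x -> a j d = 0) ->
  exists2 s, 0 < s & P (x + s *: d) /\ tight x \proper tight (x + s *: d).
Proof.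
move=> Px d0 dx; have [j0 aj0] := bounded d0.
pose q j := (b j - a j x) / a j d.
case: (@arg_minP _ _ _ j0 (fun j => 0 < a j d) q) => // j1 aj1 qmin.
have nt j : 0 < a j d -> a j x < b j.
  move=> ajd; rewrite lt_neqAle Px andbT; apply: contraTN ajd => jx.
  by rewrite dx ?ltxx// inE.
have q0 : 0 < q j1 by rewrite divr_gt0// subr_gt0 nt.
have axd j : a j (x + q j1 *: d) = a j x + q j1 * a j d by rewrite aD aZ.
exists (q j1) => //; split.
  move=> j; rewrite axd; have [ajd|ajd] := leP (a j d) 0.
    by rewrite (le_trans _ (Px j))// gerDl pmulr_rle0.
  by rewrite addrC -lerBrDr -ler_pdivlMr//; exact: qmin.
apply/properP; split.
  apply/fintype.subsetP => j jx; rewrite inE axd dx// mulr0 addr0.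
  by move: jx; rewrite inE.
exists j1; rewrite inE ?axd; last by rewrite lt_eqF// nt.
by rewrite /q divfK; [rewrite addrC subrK|rewrite gt_eqF].
Qed.

(* The vertices are the points whose tight constraints have no common kernel; a
   point which is not a vertex lies on a segment between two points with more
   tight constraints. *)
Lemma bounded_polyhedron_polytope : convex_polytope P.
Proof.
exists (vertex : set E); first exact: finite_vertex.
apply/seteqP; split=> [x Px M [cM sM]|]; last first.
  move=> x; apply; split; last by move=> y [].
  move=> y z l; rewrite !inE => Py Pz j.
  rewrite /conv /= aD !aZ.
  have l0 : 0 <= l%:num by [].
  have l1 : 0 <= unstable.onem l%:num by rewrite subr_ge0.
  rewrite (le_trans (lerD (ler_wpM2l l0 (Py j)) (ler_wpM2l l1 (Pz j))))//.
  by rewrite -mulrDl addrC subrK mul1r.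
have [n] := ubnP #|~: tight x|; elim: n x Px => // n IHn x Px xn.
have [vx|nvx] := pselect (vertex x); first exact: sM.
have [d d0 dx] : exists2 d, d != 0 & forall j, j \in tight x -> a j d = 0.
  apply: contrapT => nd; apply: nvx; split=> // d dx.
  by apply/eqP/negP => /negP d0; apply: nd; exists d.
have IH z : P z -> tight x \proper tight z -> M z.
  move=> Pz xz; apply: IHn => //.
  rewrite ltnS in xn; apply: leq_trans xn; apply: proper_card.
  by rewrite properC.
have [s s0 [Ps ts]] := ray Px d0 dx.
have [||s' s'0 [Ps' ts']] := @ray x (- d) Px.
- by rewrite oppr_eq0.
- by move=> j jx; rewrite -scaleN1r aZ dx// mulr0.
have ss : 0 < s + s' by rewrite addr_gt0.
have p0 : 0 <= s' / (s + s') by rewrite divr_ge0// ltW.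
have p1 : s' / (s + s') <= 1 by rewrite ler_pdivrMr// mul1r lerDr ltW.
have xE : (s' / (s + s')) *: (x + s *: d) +
    (1 - s' / (s + s')) *: (x + s' *: - d) = x.
  rewrite !scalerDr addrACA -scalerDl [X in X *: x]addrC subrK scale1r.
  rewrite !scalerN !scalerA -scalerBl (_ : _ - _ = 0) ?scale0r ?addr0//.
  by field; rewrite gt_eqF.
have h1 : x + s *: d \in M by rewrite inE; exact: IH.
have h2 : x + s' *: - d \in M by rewrite inE; exact: IH.
have := cM _ _ (Itv01 p0 p1) h1 h2; rewrite inE /conv /= /unstable.onem.
by rewrite xE.
Qed.

End BoundedPolyhedra.

Section RootPolytopes.
Variables (R : realType) (V : vectType R) (form : {dot V for (@idfun R)}).
Variables (r : nat) (S : based_root_system form r) (lam : 'I_r -> V).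

Lemma lformP (i : 'I_r) (c : R) (x y : {ffun nonsimple S -> R^o}) :
  lform lam (c *: x + y) i = c * lform lam x i + lform lam y i.
Proof.
rewrite /lform mulr_sumr -big_split; apply: eq_bigr => k _ /=.
by rewrite !ffunE mulrDl mulrA.
Qed.

Lemma polytope_convex (m : 'I_r -> nat) (y : V) :
  convex_polytope (polytope (S := S) lam m y).
Proof.
pose J := ((nonsimple S + nonsimple S) + ('I_r + 'I_r))%type.
pose a (j : J) (x : {ffun nonsimple S -> R^o}) : R := match j with
  | inl (inl k) => x k | inl (inr k) => - (x k : R)
  | inr (inl i) => lform lam x i | inr (inr i) => - lform lam x i end.
pose c i := fracpart (form y (lam i)) + (m i)%:R.
pose b (j : J) : R := match j with
  | inl (inl k) => 1 | inl (inr k) => 0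
  | inr (inl i) => c i | inr (inr i) => - (c i - 1) end.
rewrite (_ : polytope _ _ _ = [set x | forall j, a j x <= b j]).
  apply: bounded_polyhedron_polytope.
    move=> [[k|k]|[i|i]] e x z; rewrite /a ?ffunE ?lformP// opprD mulrN//.
  (* The box constraints suffice: a nonzero coordinate of [d] is blocked by its upper or its lower
     bound. *)
  move=> d d0; have [k dk] : exists k, d k != 0.
    apply: contrapT => nd; move/eqP: d0; apply; apply/ffunP => k; rewrite ffunE.
    by apply/eqP/negP => /negP dk; apply: nd; exists k.
  have [dk0|dk0|dk0] := ltgtP 0 (d k : R).
  - by exists (inl (inl k)).
  - by exists (inl (inr k)); rewrite /= oppr_gt0.
  - by move: dk; rewrite -dk0 eqxx.
apply/seteqP; split=> x /=.
  move=> [xk xi] [[k|k]|[i|i]] /=; rewrite ?oppr_le0 ?lerN2.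
  - by case/andP: (xk k).
  - by case/andP: (xk k).
  - by case/andP: (xi i).
  - by case/andP: (xi i).
move=> h; split=> [k|i]; apply/andP; split.
- by have := h (inl (inr k)); rewrite /= oppr_le0.
- exact: (h (inl (inl k))).
- by have := h (inr (inr i)); rewrite /= lerN2.
- exact: (h (inr (inl i))).
Qed.

End RootPolytopes.

(** * Root systems *)

Section RootSystemFacts.
Variables (R : realType) (V : vectType R) (form : {dot V for (@idfun R)}).
Variables (r : nat) (S : based_root_system form r).
Local Notation D := (root_set S).
Local Notation psi := (simple_roots S).
Local Notation al i := (tnth psi i).
Implicit Types (u v w : V) (i j : 'I_r).

Let formDl u v w : form (u + v) w = form u w + form v w.
Proof. exact: linearDl. Qed.

Let formC u v : form u v = form v u.
Proof. by rewrite hermC expr0 mul1r. Qed.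

Let formZl (c : R) u v : form (c *: u) v = c * form u v.
Proof. exact: linearZl_LR. Qed.

Let formDr u v w : form w (u + v) = form w u + form w v.
Proof. by rewrite formC formDl !(formC w). Qed.

Let formZr (c : R) u v : form u (c *: v) = c * form u v.
Proof. by rewrite formC formZl formC. Qed.

Let formNr u v : form u (- v) = - form u v.
Proof. by rewrite -scaleN1r formZr mulN1r. Qed.

Let formNl u v : form (- u) v = - form u v.
Proof. by rewrite -scaleN1r formZl mulN1r. Qed.

Let form_gt0 u : u != 0 -> 0 < form u u.
Proof. exact: neq0_dnorm_gt0. Qed.

Let form_suml (I : Type) (s : seq I) (F : I -> V) v :
  form (\sum_(k <- s) F k) v = \sum_(k <- s) form (F k) v.
Proof.
elim: s => [|k s IHs]; last by rewrite !big_cons formDl IHs.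
by rewrite !big_nil -[0 in LHS](scale0r 0) formZl mul0r.
Qed.

Let free_psi : free psi.
Proof. by have [/andP[_]] := simpleP S. Qed.

Let alD i : al i \in D.
Proof. by have [] := simpleP S. Qed.

Let D0 v : v \in D -> v != 0.
Proof.
have [_ D0 _ _ _] := rootsP S.
by move=> vD; apply: contraNneq D0 => <-.
Qed.

Let al0 i : 0 < form (al i) (al i). Proof. exact/form_gt0/D0. Qed.

Let coord_al i j : coord psi i (al j) = (i == j)%:R.
Proof. by rewrite (tnth_nth 0) coord_free// eq_sym. Qed.

Let decomp v : v = \sum_i coord psi i v *: al i.
Proof.
have [/andP[/eqP full _] _ _] := simpleP S.
rewrite {1}(@coord_span _ _ _ psi v) ?full ?memvf//.
by apply: eq_bigr => i _; rewrite (tnth_nth 0).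
Qed.

Let reflD a b : a \in D -> b \in D -> reflection form a b \in D.
Proof. by have [_ _ + _ _] := rootsP S; apply. Qed.

Let opp_root a : a \in D -> - a \in D.
Proof.
move=> aD; have := reflD aD aD.
rewrite /reflection /coroot formZl divfK ?gt_eqF ?form_gt0 ?D0//.
by rewrite scaler_nat mulr2n opprD addrA subrr sub0r.
Qed.

Let coord_refl i j v : coord psi j (reflection form (al i) v) =
  coord psi j v - form (coroot form (al i)) v * (j == i)%:R.
Proof. by rewrite /reflection linearB linearZ /= coord_al. Qed.

Let pos v := forall i, 0 <= coord psi i v.

Let pos_or_neg a : a \in D -> pos a \/ pos (- a).
Proof.
have [_ _ h] := simpleP S.
by move=> /h[n|n]; [left|right] => i; rewrite ?linearN /= natr_ge0.
Qed.

Let pos_coord a i : a \in D -> 0 < coord psi i a -> pos a.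
Proof.
move=> /pos_or_neg[//|/(_ i)]; rewrite linearN /= oppr_ge0 => + c0.
by rewrite leNgt c0.
Qed.

Let simple_of_prop a i : a \in D -> pos a ->
  (forall j, j != i -> coord psi j a = 0) -> a = al i.
Proof.
move=> aD ap ac; have aE : a = coord psi i a *: al i.
  rewrite {1}(decomp a) (bigD1 i)//= big1 ?addr0// => j ji.
  by rewrite ac ?scale0r.
have [_ _ _ _ red] := rootsP S.
have := red (al i) (coord psi i a) (alD i); rewrite -aE => /(_ aD)[c1|c1].
  by rewrite aE c1 scale1r.
by have := ap i; rewrite c1 lerNr oppr0 ler10.
Qed.

(** As (a, a) > 0, some simple root with a positive coefficient in [a] has positive product with
    [a]. Its reflection alters only that coefficient, and reducedness provides another nonzero one,
    which forces the image to be positive. *)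
Lemma coroot_refl_pos a : a \in D -> pos a -> (forall i, a != al i) ->
  exists2 i, 0 < form (coroot form (al i)) a & reflection form (al i) a \in D
     /\ pos (reflection form (al i) a).
Proof.
move=> aD ap an.
have [i ci] : exists i, 0 < coord psi i a * form (al i) a.
  apply: contrapT => nh; have := form_gt0 (D0 aD).
  rewrite {1}(decomp a) form_suml ltNge => /negP; apply.
  by apply: sumr_le0 => i _; rewrite formZl leNgt; apply/negP => h; apply: nh; exists i.
have c0 : 0 < coord psi i a.
  by rewrite lt_neqAle ap andbT; apply: contraTneq ci => <-; rewrite mul0r ltxx.
have f0 : 0 < form (al i) a by rewrite pmulr_rgt0 in ci.
exists i; first by rewrite /coroot formZl mulr_gt0// divr_gt0.
have bD := reflD (alD i) aD; split=> //.
have [j ji cj] : exists2 j, j != i & coord psi j a != 0.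
  apply: contrapT => nh; have /eqP := an i; apply; apply: simple_of_prop => // j ji.
  by apply/eqP/negP => /negP cj; apply: nh; exists j.
apply: (@pos_coord _ j) => //.
by rewrite coord_refl (negbTE ji) mulr0 subr0 lt_neqAle eq_sym cj ap.
Qed.

Let sum_coord_nat a : a \in D -> pos a -> \sum_i coord psi i a \is a Num.nat.
Proof.
move=> aD ap; apply: rpred_sum => i _.
have [_ _ /(_ a aD)[//|/(_ i)]] := simpleP S.
have := ap i; rewrite le_eqVlt => /predU1P[<- _|c0 /natr_ge0]; first exact: nat_num0.
by rewrite oppr_ge0 leNgt c0.
Qed.

Variable lam : 'I_r -> V.
Hypothesis lamP : fundamental_weights S lam.

Let form_al_lam i j : form (al i) (lam j) = (i == j)%:R * (form (al i) (al i) / 2).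
Proof.
rewrite -(lamP i j) /coroot formZl.
by field; rewrite gt_eqF ?al0.
Qed.

Let form_lam v j :
  form v (lam j) = coord psi j v * (form (al j) (al j) / 2).
Proof.
rewrite {1}(decomp v) form_suml (bigD1 j)//= big1 => [|i ij].
  by rewrite formZl form_al_lam eqxx mul1r addr0.
by rewrite formZl form_al_lam (negbTE ij) mul0r mulr0.
Qed.

(** lambda_j is orthogonal to every simple root but the j-th, so the pairing reads off one
    coordinate. For a root the remaining factor is positive, and the coordinate decides sign and
    vanishing. *)
Lemma coroot_lam_coord v j :
  form (coroot form v) (lam j) = coord psi j v * (form (al j) (al j) / form v v).
Proof. by rewrite /coroot formZl form_lam; move: (form v v)^-1 => n; field. Qed.

Let form_refl i a :
  form (reflection form (al i) a) (reflection form (al i) a) = form a a.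
Proof.
rewrite /reflection /coroot !formZl formDl formNl formZl !formDr !formNr !formZr.
by rewrite (formC a (al i)); field; rewrite gt_eqF ?al0.
Qed.

Lemma coroot_lam_int a j : a \in D -> pos a ->
  form (coroot form a) (lam j) \is a Num.int.
Proof.
move=> aD ap.
have [n] : exists n : nat, \sum_i coord psi i a < n%:R.
  by have /natrP[n ->] := sum_coord_nat aD ap; exists n.+1; rewrite ltr_nat.
elim: n a aD ap => [|n IHn] a aD ap.
  by rewrite ltNge sumr_ge0// => i _; exact: ap.
have [_ _ _ integral _] := rootsP S.
have [[i ->] _|an an1] := pselect (exists i, a = al i).
  rewrite lamP; exact: intr_nat.
have [|i k0 [bD bp]] := coroot_refl_pos aD ap.
  by move=> i; apply/eqP => ai; apply: an; exists i.
pose b := reflection form (al i) a; pose k := form (coroot form (al i)) a.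
have kint : k \is a Num.int by exact: integral.
have k1 : 1 <= k.
  by move: k0 kint; rewrite -/k => k0 /intrP[m km]; move: k0; rewrite km ltr0z ler1z.
have hb : \sum_l coord psi l b < n%:R.
  rewrite (_ : \sum_l _ = \sum_l coord psi l a - k).
    by rewrite ltrBlDr (lt_le_trans an1)// -natr1 lerD2l.
  under eq_bigr do rewrite coord_refl; rewrite sumrB; congr (_ - _).
  rewrite (bigD1 i)//= eqxx mulr1 big1 ?addr0// => l /negbTE ->.
  by rewrite mulr0.
(* Reflections are isometries, so the coroot of [b] is the reflected coroot of [a]; thus the coroots
   of [a] and [b] differ by an integral multiple of the i-th simple coroot. *)
have aE : form (coroot form a) (lam j) =
    form (coroot form b) (lam j) + (i == j)%:R * form (coroot form a) (al i).
  rewrite !coroot_lam_coord form_refl coord_refl /coroot !formZl (formC a (al i)).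
  have [ij|ij] := eqVneq i j; last by rewrite mulr0 subr0 mul0r addr0.
  rewrite ij /= mulr1 mul1r; field.
  by rewrite !gt_eqF ?al0 ?form_gt0 ?D0.
rewrite aE rpredD ?rpredM ?IHn//; first exact: intr_nat.
exact: integral.
Qed.

Let posrP (a : pos_roots S) : val a \in D /\ pos (val a).
Proof. by have := valP a; rewrite !inE => /andP[aD /forallP]. Qed.

Lemma pairing_coord (a : pos_roots S) i :
  (pairing lam a i != 0) = (coord psi i (val a) != 0).
Proof.
have [aD _] := posrP a.
rewrite /pairing coroot_lam_coord mulf_eq0 negb_or andb_idr// => _.
exact: mulf_neq0 (lt0r_neq0 (al0 i)) (invr_neq0 (lt0r_neq0 (form_gt0 (D0 aD)))).
Qed.

Lemma pairing_ge0 (a : pos_roots S) i : 0 <= pairing lam a i.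
Proof.
have [aD ap] := posrP a.
by rewrite /pairing coroot_lam_coord mulr_ge0// divr_ge0 ?ltW ?form_gt0 ?D0.
Qed.

Lemma pairing_simple i j : pairing lam (simple_root S i) j = (i == j)%:R.
Proof. exact: lamP. Qed.

Lemma simple_root_inj : injective (simple_root S).
Proof.
move=> i j /(congr1 val)/= ij.
have := coord_al i i; rewrite eqxx ij coord_al; case: eqP => // _ /eqP.
by rewrite eq_sym oner_eq0.
Qed.

Lemma big_pos_roots (T : Type) (idx : T) (op : Monoid.com_law idx)
    (F : pos_roots S -> T) :
  \big[op/idx]_a F a =
  op (\big[op/idx]_(a : nonsimple S) F (val a)) (\big[op/idx]_i F (simple_root S i)).
Proof.
rewrite (bigID (fun a => val a \notin psi)) /=; congr (op _ _).
  rewrite (reindex_omap (val : nonsimple S -> pos_roots S) insub) /=.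
    apply: eq_bigl => a; rewrite (valP a) /=.
    by rewrite valK eqxx.
  by move=> a an; rewrite insubT.
rewrite [RHS](eq_bigl (fun i => i \in predT))//.
rewrite -(big_imset F (h := simple_root S)); last by move=> i j _ _; exact: simple_root_inj.
apply: eq_bigl => a; rewrite negbK; apply/idP/imsetP.
  move=> /tnthP[i ai]; exists i => //; exact: val_inj.
by move=> [i _ ->]; exact: mem_tnth.
Qed.

(** The truncation is exact because the number is a nonnegative integer. Among the simple roots only
    the i-th contributes, and it gives the 1. *)
Lemma mboundE i :
  (mbound S lam i)%:R = 1 + \sum_(a : nonsimple S) pairing lam (val a) i.
Proof.
have e : 2 * form (corho S) (lam i) = \sum_(a : pos_roots S) pairing lam a i.
  rewrite /corho formZl mulrA mulfV ?pnatr_eq0// mul1r form_suml.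
  by [].
rewrite /mbound e truncnK.
  rewrite big_pos_roots /= addrC; congr (_ + _).
  under eq_bigr do rewrite pairing_simple.
  rewrite (bigD1 i)//= eqxx big1 ?addr0// => j /negbTE -> //.
rewrite natrEint; apply/andP; split.
  apply: rpred_sum => a _; have [aD ap] := posrP a; exact: coroot_lam_int.
by apply: sumr_ge0 => a _; exact: pairing_ge0.
Qed.

(** Suppose the i-th simple root is the only positive root involving itself. Any other simple root
    is then orthogonal to it, for otherwise reflecting it would produce a second such positive root.
    So the pair of opposite roots splits off: it is all of the system, of type A_1, or the system is
    reducible. *)
Lemma irreducible_pairing i : irreducible_roots form D -> ~ type_A1 D ->
  exists a : nonsimple S, pairing lam (val a) i != 0.
Proof.
move=> [_ irr] nA1; apply: contrapT => nh.
have simple1 a : a \in D -> pos a -> coord psi i a != 0 -> a = al i.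
  move=> aD ap ai.
  have aP : a \in pos_roots S by rewrite !inE aD; apply/forallP.
  have [ap'|an] := boolP (a \in psi).
    have /tnthP[j aj] := ap'; move: ai; rewrite aj coord_al.
    by case: (eqVneq i j) => [->//|_]; rewrite eqxx.
  exfalso; apply: nh; exists (Sub [` aP] an : nonsimple S).
  by rewrite pairing_coord.
have orth j : j != i -> form (al i) (al j) = 0.
  move=> ji; apply/eqP/negP => /negP fij.
  pose b := reflection form (al j) (al i).
  have bD : b \in D by apply: reflD.
  have bi : coord psi i b = 1.
    by rewrite coord_refl coord_al eqxx [i == j]eq_sym (negbTE ji) mulr0 subr0.
  have bp : pos b by apply: (@pos_coord _ i) => //; rewrite bi.
  have bE := simple1 b bD bp; move: bE; rewrite bi oner_eq0 => /(_ isT) bE.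
  have := coord_refl j j (al i); rewrite -/b bE eqxx mulr1 => /eqP.
  rewrite -subr_eq0 opprB addrC subrK /coroot formZl formC mulf_eq0 (negbTE fij) orbF.
  by rewrite mulf_eq0 pnatr_eq0 invr_eq0 (gt_eqF (al0 j)).
have D1 a : a \in D -> coord psi i a != 0 -> a = al i \/ a = - al i.
  move=> aD ai; case: (pos_or_neg aD) => ap; [left; exact: simple1|right].
  by rewrite -(simple1 (- a)) ?opprK ?opp_root// linearN oppr_eq0.
pose E1 : {fset V} := [fset a in D | coord psi i a != 0].
pose E2 : {fset V} := [fset a in D | coord psi i a == 0].
have [E20|E20] := eqVneq E2 fset0.
  apply: nA1; exists (al i); apply/fsetP => a; rewrite !inE.
  apply/idP/orP => [aD|[/eqP ->|/eqP ->]//]; last exact: opp_root.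
  have : a \notin E2 by rewrite E20 inE.
  rewrite !inE aD /= => /(D1 a aD)[->|->]; [left|right]; exact: eqxx.
apply: irr; exists E1, E2; split=> //.
- apply/eqP => /fsetP/(_ (al i)); rewrite !inE alD coord_al eqxx.
  by rewrite oner_eq0.
- by apply/fsetP => a; rewrite !inE -andb_orr orNb andbT.
- move=> a b; rewrite !inE => /andP[aD /(D1 a aD) ai] /andP[bD /eqP bi].
  have : form b (al i) = 0.
    rewrite {1}(decomp b) form_suml big1// => j _; rewrite formZl.
    have [->|ji] := eqVneq j i; first by rewrite bi mul0r.
    by rewrite formC orth// mulr0.
  by rewrite formC; case: ai => ->; rewrite ?formNl => ->; rewrite ?oppr0.
Qed.

End RootSystemFacts.

(** * Generating functions of root systems *)

Section MultiIndices.
Variable I : finType.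

Definition ord_multi N (f : {ffun I -> 'I_N}) : {ffun I -> nat} :=
  [ffun a => nat_of_ord (f a)].

(** Boxes are cofinal among the finite sets of multi-indices, and over a box a sum of products
    factors into a product of sums. *)
Definition box (N : nat) : {fset {ffun I -> nat}} :=
  [fset ord_multi f | f in {: {ffun I -> 'I_N}}].

Lemma in_box N (k : {ffun I -> nat}) : (k \in box N) = [forall a, (k a < N)%N].
Proof.
apply/imfsetP/forallP => [[f _ -> a]|kN]; first by rewrite ffunE.
exists [ffun a => Ordinal (kN a)] => //.
by apply/ffunP => a; rewrite !ffunE.
Qed.

Lemma box_bound (B : {fset {ffun I -> nat}}) : exists N, (B `<=` box N)%fset.
Proof.
exists (\max_(k <- B) \max_a k a).+1; apply/fsubsetP => k kB.
rewrite in_box; apply/forallP => a; rewrite ltnS.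
have h1 : (k a <= \max_b k b)%N by exact: (@leq_bigmax _ (fun b => k b) a).
by rewrite (big_rem k kB) /= leq_max h1.
Qed.

Lemma sum_box (K : comNzRingType) N (F : I -> nat -> K) :
  \sum_(k <- box N) \prod_a F a (k a) = \prod_a \sum_(j < N) F a j.
Proof.
rewrite bigA_distr_bigA /= big_imfset /=; last first.
  move=> f g _ _ fg; apply/ffunP => a; apply: val_inj.
  by have /ffunP/(_ a) := fg; rewrite !ffunE.
rewrite big_enum /=; apply: eq_bigr => f _.
by apply: eq_bigr => a _; rewrite ffunE.
Qed.

End MultiIndices.

Lemma sum_fsubset (T : choiceType) (K : zmodType) (A B : {fset T}) (F : T -> K) :
  (A `<=` B)%fset -> \sum_(k <- A) F k = \sum_(k <- B | k \in A) F k.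
Proof.
move=> /fsubsetP AB; rewrite -[RHS]big_filter; apply: perm_big; apply: uniq_perm.
- exact: fset_uniq.
- by rewrite filter_uniq// fset_uniq.
- by move=> k; rewrite mem_filter; case kA : (k \in A) => //=; rewrite AB.
Qed.

Lemma cvg_prod_seq (K : numFieldType) (T : Type) (s : seq T)
    (f : T -> nat -> K^o) (l : T -> K^o) :
  (forall a, f a @ \oo --> l a) ->
  (fun N => \prod_(a <- s) f a N : K^o) @ \oo --> (\prod_(a <- s) l a : K^o).
Proof.
move=> fl; elim: s => [|a s IHs].
  by under eq_fun do rewrite big_nil; rewrite big_nil; exact: cvg_cst.
by under eq_fun do rewrite big_cons; rewrite big_cons; exact: cvgM.
Qed.

(** * Fractional parts and unit layers *)

Section FractionalPart.
Variable R : realType.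

Lemma fracpart_ge0 (x : R) : 0 <= fracpart x.
Proof. by rewrite /fracpart subr_ge0 floor_le. Qed.

Lemma fracpart_lt1 (x : R) : fracpart x < 1.
Proof. by rewrite /fracpart ltrBlDl -intrD1 floorD1_gt. Qed.

Lemma fracpart_eq (x y : R) (n : int) : x = y + n%:~R -> fracpart x = fracpart y.
Proof.
move=> ->; rewrite /fracpart floorDrz ?intr_int// intrKfloor intrD opprD.
by rewrite addrACA subrr addr0.
Qed.

(** Closed unit layers meet only at common endpoints, and the strict lower bound for m excludes the
    overlap with m - 1; only the face shared with m + 1 is left. *)
Lemma layer_cases (c z : R) (m m' : nat) :
  c + m%:R - 1 < z -> z <= c + m%:R -> c + m'%:R - 1 <= z -> z <= c + m'%:R ->
  m' = m \/ m' = m.+1 /\ z = c + m'%:R - 1.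
Proof.
move=> k1 k2 l1 l2.
have lt1 : (m < m'.+1)%N by rewrite -(ltr_nat R) -natr1; lra.
have : (m' <= m.+1)%N by rewrite -ltnS -(ltr_nat R) -!natr1; lra.
rewrite leq_eqVlt => /orP[/eqP mm|lt2]; [right|left]; last first.
  by apply/eqP; rewrite eqn_leq -ltnS lt2 -ltnS lt1.
split=> //; apply: le_anti; rewrite l1 andbT mm -natr1; lra.
Qed.

Lemma nice_fracpart (I : finType) (f : {ffun I -> R^o} -> R) :
  nice f -> nice (fun x => fracpart (f x)).
Proof.
move=> [mf _]; apply: nice_comp => //.
  apply: measurable_funB => //.
  apply: nondecreasing_measurable => // x y xy.
  by rewrite ler_int; exact: le_floor.
exists 1 => x _; rewrite ger0_norm ?fracpart_ge0//.
exact: ltW (fracpart_lt1 _).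
Qed.

End FractionalPart.

(** * From the Bernoulli series to the sum over polytopes *)

Section GeneratingFunction.
Variables (R : realType) (V : vectType R) (form : {dot V for (@idfun R)}).
Variables (r : nat) (S : based_root_system form r).
Variables (lam : 'I_r -> V) (lamP : fundamental_weights S lam).
Variables (t : pos_roots S -> R[i]).
Hypothesis ht : forall a, normc (t a) < 2 * pi.
Variable y : V.
Local Notation pt := {ffun nonsimple S -> R^o}.

(* The argument of [B_{k_a}] in [P(k, y)] for an arbitrary positive root [a]. *)
Let ev (x : pt) (a : pos_roots S) : R :=
  if insub a is Some b then x (b : nonsimple S) else
  if [pick i | simple_root S i == a] is Some i then
    fracpart (form y (lam i) - lform lam x i) else 0.

Let ev_nonsimple x (a : nonsimple S) : ev x (val a) = x a.
Proof. by rewrite /ev valK. Qed.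

Let ev_simple x i : ev x (simple_root S i) = fracpart (form y (lam i) - lform lam x i).
Proof.
rewrite /ev insubF; last by apply/negbTE; rewrite negbK; exact: mem_tnth.
case: pickP => [j /eqP/(simple_root_inj) -> //|/(_ i)].
by rewrite eqxx.
Qed.

Let ev01 x a : cube x -> 0 <= ev x a <= 1.
Proof.
move=> cx; rewrite /ev; case: insubP => [b _ _|_]; first exact: cx.
case: pickP => [i _|_]; last by rewrite lexx ler01.
by rewrite fracpart_ge0 ltW ?fracpart_lt1.
Qed.

Lemma nice_lform i : nice (fun x : pt => lform lam x i).
Proof.
by apply: nice_sum => a; apply: niceM; [exact: nice_coord|exact: nice_cst].
Qed.

Let nice_ev a : nice (fun x : pt => ev x a).
Proof.
rewrite /ev; case: (insub a) => [b|]; first exact: nice_coord.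
case: pickP => [i _|_]; last exact: nice_cst.
by apply/nice_fracpart/niceB; [exact: nice_cst|exact: nice_lform].
Qed.

Let T (k : {ffun pos_roots S -> nat}) (x : pt) : R[i] :=
  \prod_a (t a ^+ k a * ((nbern R (k a)).[ev x a])%:C).

Let cnice_T k : cnice (T k).
Proof.
apply: cnice_prod => a; apply: cniceM; first exact: cnice_cst.
by apply: cnice_real; exact: nice_horner.
Qed.

Let genfun_termE k : genfun_term lam t y k = cint_cube (T k).
Proof.
pose F (x : pt) : R := \prod_a (bernoulli_poly R (k a)).[ev x a].
have nF : nice F by apply: nice_prod => a; exact: nice_horner.
have -> : cint_cube (T k) =
    (\prod_a (t a ^+ k a / (k a)`!%:R)) * cint_cube (fun x => (F x)%:C).
  rewrite -cint_cubeZ; last exact: cnice_real.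
  apply: eq_cint_cube => x _; rewrite rmorph_prod -big_split /=.
  by apply: eq_bigr => a _; rewrite /nbern hornerZ rmorphM fmorphV rmorph_nat mulrA.
rewrite mulrC /genfun_term; congr (_ * _).
rewrite /cint_cube /ciint /iint /= iint_seq_cst /P_coef /int_cube /iint.
congr (_ +i* _); apply: eq_iint_seq; first exact: cube0.
move=> x _; rewrite /F (big_pos_roots _ (fun a => (bernoulli_poly R (k a)).[ev x a])) /=.
congr (_ * _); apply: eq_bigr => a _; first by rewrite ev_nonsimple.
by rewrite ev_simple.
Qed.

Let M (k : {ffun pos_roots S -> nat}) : R :=
  \prod_a (mbern R (k a) * normc (t a) ^+ k a).

Let M_ge0 k : 0 <= M k.
Proof.
by apply: prodr_ge0 => a _; rewrite mulr_ge0 ?mbern_ge0 ?exprn_ge0 ?normc_ge0.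
Qed.

Let T_le k x : cube x -> normc (T k x) <= M k.
Proof.
move=> cx; rewrite normc_prod; apply: ler_prod => a _.
rewrite normc_ge0/= ComplexField.Normc.normcM normcX normc_real mulrC.
by rewrite ler_wpM2r ?exprn_ge0 ?normc_ge0// nbern_le// ev01.
Qed.

(** Over boxes the majorant factors into a product of bounded nondecreasing one-variable partial
    sums, so its box sums converge. *)
Let tail (e : R) : 0 < e -> exists N0, forall N, (N0 <= N)%N ->
  \sum_(k <- box _ N) M k - \sum_(k <- box _ N0) M k <= e.
Proof.
move=> e0.
pose s a N := \sum_(j < N) (mbern R j * normc (t a) ^+ j).
pose s' N : R := \prod_a s a N.
have sE N : \sum_(k <- box _ N) M k = s' N.
  exact: (sum_box N (fun a j => mbern R j * normc (t a) ^+ j)).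
have s_nd a : nondecreasing_seq (s a).
  move=> m n mn; rewrite /s -!(big_mkord predT (fun j => mbern R j * normc (t a) ^+ j)).
  rewrite (big_cat_nat _ mn)//= lerDl; apply: sumr_ge0 => j _.
  by rewrite mulr_ge0 ?mbern_ge0 ?exprn_ge0 ?normc_ge0.
have s0 a N : 0 <= s a N.
  by apply: sumr_ge0 => j _; rewrite mulr_ge0 ?mbern_ge0 ?exprn_ge0 ?normc_ge0.
have sB : forall a, exists B, forall N, s a N <= B.
  by move=> a; apply: mbern_bounded; rewrite normc_ge0 ht.
have s'_nd : nondecreasing_seq s'.
  by move=> m n mn; apply: ler_prod => a _; rewrite s0 s_nd.
have [B sB'] := choice sB.
have s'_cvg : cvgn s'.
  apply: nondecreasing_is_cvgn => //; exists (\prod_a B a) => _ [N _ <-].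
  by apply: ler_prod => a _; rewrite s0 sB'.
have /cvgrPdist_le/(_ e e0)[N0 _ hN0] := s'_cvg.
exists N0 => N N0N; rewrite !sE.
have := hN0 N0 (leqnn N0).
rewrite ger0_norm ?subr_ge0 ?nondecreasing_cvgn_le// => h.
by rewrite (le_trans _ h)// lerB// nondecreasing_cvgn_le.
Qed.

Let G (x : pt) : R[i] := \prod_a (todd (t a) * cexp (t a * (ev x a)%:C)).

Let cnice_G : cnice G.
Proof.
apply: cnice_prod => a; apply: cniceM; first exact: cnice_cst.
apply/cnice_cexp/cniceM; first exact: cnice_cst.
exact: cnice_real.
Qed.

(** Uniformity in x: [N0] comes from the majorant alone. The box size [N] may depend on x and [A],
    since the gap between the sums over [A] and over that box is bounded by the tail of the majorant
    beyond [N0]. *)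
Let approx (e : R) : 0 < e -> exists N0, forall A : {fset {ffun pos_roots S -> nat}},
  (box _ N0 `<=` A)%fset -> forall x, cube x ->
  normc (\sum_(k <- A) T k x - G x) <= e.
Proof.
move=> e0; have e20 : 0 < e / 2 by rewrite divr_gt0.
have [N0 hN0] := tail e20; exists N0 => A NA x cx.
have [N1 AN1] := box_bound A.
have cvgG : (fun N => \sum_(k <- box _ N) T k x : R[i]^o) @ \oo --> (G x : R[i]^o).
  under eq_fun do rewrite (sum_box _ (fun a j => t a ^+ j * ((nbern R j).[ev x a])%:C)).
  apply: cvg_prod_seq => a; apply: bernoulli_generating => //; exact: ev01.
have /cvg_normcP/(_ _ e20)[N2 _ hN2] := cvgG.
pose N := maxn N0 (maxn N1 N2).
have N0N : (N0 <= N)%N by rewrite leq_maxl.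
have boxS m : (m <= N)%N -> (box _ m `<=` box (pos_roots S) N)%fset.
  move=> mN; apply/fsubsetP => k; rewrite !in_box => /forallP km.
  by apply/forallP => a; rewrite (leq_trans (km a)).
have AN : (A `<=` box _ N)%fset.
  by apply: fsubset_trans AN1 (boxS _ _); rewrite !leq_max leqnn orbT.
have hG := hN2 N; rewrite /= !leq_max leqnn !orbT in hG.
have {}hG := hG isT.
rewrite (_ : _ - _ = (\sum_(k <- A) T k x - \sum_(k <- box _ N) T k x) -
   (G x - \sum_(k <- box _ N) T k x)); last by rewrite opprB addrA subrK.
rewrite (le_trans (normcD _ _))// (@normcN R).
rewrite [leRHS](_ : e = e / 2 + e / 2); last by field.
apply: lerD => //.
rewrite (sum_fsubset _ AN) [X in _ - X](bigID (fun k => k \in A)) /= opprD addrA.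
rewrite subrr sub0r (@normcN R) (le_trans (normc_sum _ _ _))//.
apply: le_trans (hN0 N N0N).
rewrite (sum_fsubset _ (boxS _ N0N)) [X in _ <= X - _](bigID (fun k => k \in box _ N0)) /=.
rewrite addrC addrK [leRHS]big_mkcond [leLHS]big_mkcond /=; apply: ler_sum => k _.
case: ifPn => [kA|_]; last by case: ifP.
have -> : (k \notin box _ N0) by apply: contra kA => /(fsubsetP NA).
exact: T_le.
Qed.

Let partial_sumE A : partial_sum (genfun_term lam t y) A =
  cint_cube (fun x => \sum_(k <- A) T k x).
Proof.
rewrite /partial_sum -(big_seq_fsetE _ _ predT (genfun_term lam t y)) /=.
have := cint_cube_sum (enum_fset A) (fun=> 1) cnice_T.
under [X in cint_cube X]eq_fun do under eq_bigr do rewrite mul1r.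
move=> ->; apply: eq_bigr => k _; rewrite mul1r genfun_termE//.
Qed.

Let cvg_genfun :
  (partial_sum (genfun_term lam t y) A @[A --> totally]) --> (cint_cube G : R[i]^o).
Proof.
have FF := @totally_filter {ffun pos_roots S -> nat}.
apply/cvg_normcP => e e0; have e20 : 0 < e / 2 by rewrite divr_gt0.
have [N0 hN0] := approx e20; exists (box _ N0) => // A /= NA.
rewrite partial_sumE normc_distC.
rewrite [leRHS](_ : e = e / 2 + e / 2); last by field.
apply: cint_cube_dist_le => //; last exact: hN0.
exact: cnice_sum.
Qed.

Lemma genfun_cvg : genfun_converges lam t y.
Proof. by apply/cvg_ex; exists (cint_cube G); exact: cvg_genfun. Qed.

Let E (x : pt) : R[i] := (\prod_(a : nonsimple S) cexp (t (val a) * (x a : R)%:C)) *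
  \prod_(i < r) cexp (t (simple_root S i) *
     (fracpart (form y (lam i) - lform lam x i))%:C).

Let cnice_E : cnice E.
Proof.
apply: cniceM; apply: cnice_prod => a; apply: cnice_cexp; apply: cniceM.
- exact: cnice_cst.
- by apply: cnice_real; exact: nice_coord.
- exact: cnice_cst.
- by apply/cnice_real/nice_fracpart/niceB; [exact: nice_cst|exact: nice_lform].
Qed.

Lemma genfun_cube : genfun lam t y = (\prod_a todd (t a)) * cint_cube E.
Proof.
have FF := @totally_filter {ffun pos_roots S -> nat}.
rewrite -cint_cubeZ//.
transitivity (cint_cube G); first exact: (cvg_lim (@norm_hausdorff _ R[i]^o) cvg_genfun).
apply: eq_cint_cube => x _; rewrite /G big_split /=; congr (_ * _).
rewrite (big_pos_roots _ (fun a => cexp (t a * (ev x a)%:C))) /=; congr (_ * _).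
  by apply: eq_bigr => a _; rewrite ev_nonsimple.
by apply: eq_bigr => i _; rewrite ev_simple.
Qed.

Let phi (x : pt) : R[i] := cexp (\sum_(a : nonsimple S) tstar lam t a * (x a : R)%:C).

Let coef (m : 'I_r -> nat) : R[i] := cexp (\sum_(i < r) t (simple_root S i) *
                    (fracpart (form y (lam i)) + (m i)%:R)%:C).

Let cnice_phi : cnice phi.
Proof.
apply/cnice_cexp/cnice_sum => a; apply: cniceM; first exact: cnice_cst.
by apply: cnice_real; exact: nice_coord.
Qed.

Lemma polytope_cube m : (polytope (S := S) lam m y `<=` @cube R (nonsimple S))%classic.
Proof. by move=> x []. Qed.

Lemma measurable_polytope m :
  measurable (polytope (S := S) lam m y : set (mpt R (nonsimple S))).
Proof.
pose c i := fracpart (form y (lam i)) + (m i)%:R.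
rewrite (_ : polytope _ _ _ =
   ((\bigcap_(a in [set: nonsimple S])
       ([set x : pt | 0 <= (x a : R)] `&` [set x : pt | (x a : R) <= 1])) `&`
    (\bigcap_(i in [set: 'I_r])
       ([set x : pt | c i - 1 <= lform lam x i] `&`
        [set x : pt | lform lam x i <= c i])))%classic); last first.
  apply/seteqP; split=> x /=.
    by move=> [h1 h2]; split=> [a _|i _]; [have /andP[] := h1 a|have /andP[] := h2 i].
  by move=> [h1 h2]; split=> [a|i]; apply/andP; [have [] := h1 a I|have [] := h2 i I].
apply: measurableI; apply: fin_bigcap_measurable => //; try exact: finite_finset.
- move=> a _; apply: measurableI; [apply: measurable_ge_cst|apply: measurable_le_cst];
    by case: (nice_coord R a).
- move=> i _; apply: measurableI; [apply: measurable_ge_cst|apply: measurable_le_cst];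
    by case: (nice_lform i).
Qed.

Lemma lform_le (x : pt) i : cube x ->
  0 <= lform lam x i <= (mbound S lam i)%:R - 1.
Proof.
move=> cx; rewrite mboundE// [1 + _]addrC addrK; apply/andP; split.
  apply: sumr_ge0 => a _; have /andP[xa0 _] := cx a.
  by rewrite mulr_ge0 ?pairing_ge0.
apply: ler_sum => a _; have /andP[_ xa1] := cx a.
by rewrite ler_piMl ?pairing_ge0.
Qed.

(** With w = {<y, lambda_i>} - z < 1, the index is m = - floor(w), a natural number. The bounds 0 <=
    w + m < 1 put z in the layer, strictly above its lower end, and z <= [mbound] - 1 keeps m in
    range. *)
Lemma exists_layer (x : pt) i : cube x -> exists m : 'I_(mbound S lam i),
  let c := fracpart (form y (lam i)) + m%:R in
  [/\ c - 1 < lform lam x i, lform lam x i <= c &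
      fracpart (form y (lam i) - lform lam x i) = c - lform lam x i].
Proof.
move=> cx; have /andP[z0 zn] := lform_le i cx.
set z := lform lam x i in z0 zn *.
pose w := fracpart (form y (lam i)) - z.
have w1 : w < 1 by have := fracpart_lt1 (form y (lam i)); rewrite /w; lra.
have fw : Num.floor w <= 0 by rewrite -ltzD1 add0r floor_lt_int.
have [m mE] : exists m : nat, Num.floor w = - m%:Z.
  exists `|Num.floor w|%N; rewrite -abszN gez0_abs ?oppr_ge0// opprK//.
have wE : fracpart w = w + m%:R by rewrite /fracpart mE intrN opprK.
have frE : fracpart (form y (lam i) - z) = fracpart w.
  apply: (@fracpart_eq _ _ _ (Num.floor (form y (lam i)))).
  by rewrite /w /fracpart; ring.
have := fracpart_ge0 w; have := fracpart_lt1 w; rewrite wE /w => h1 h0.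
have f0 := fracpart_ge0 (form y (lam i)).
have mn : (m < mbound S lam i)%N by rewrite -(ltr_nat R); lra.
exists (Ordinal mn); split => /=; [lra|lra|].
by rewrite frE wE /w; ring.
Qed.

Lemma cint_cube_polytopes : cint_cube E = \sum_(m : mindex S lam)
  coef (fun i => m i) * cint_over (polytope lam (fun i => m i) y) phi.
Proof.
pose Q (m : mindex S lam) (x : pt) : R[i] :=
  if x \in polytope lam (fun i => m i) y then phi x else 0.
have nQ m : cnice (Q m) by apply: cnice_if => //; exact: measurable_polytope.
rewrite (eq_bigr (fun m : mindex S lam => coef (fun i => m i) * cint_cube (Q m)));
  last by move=> m _; rewrite cint_over_cube//; exact: polytope_cube.
rewrite -(cint_cube_sum _ (fun m : mindex S lam => coef (fun i => m i)) nQ).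
pose F x := \sum_(m : mindex S lam) coef (fun i => m i) * Q m x.
have nF : cnice F by apply: cnice_sum => m; apply: cniceM => //; exact: cnice_cst.
pose N := (\max_i mbound S lam i)%N.
(* Indexes the lower faces of all layers, [N] bounding every m_i. Only those i whose linear form is
   not identically 0 are kept, so that each face is a genuine hyperplane. *)
pose K := {p : 'I_r * 'I_N | [exists a : nonsimple S, pairing lam (val a) p.1 != 0]}.
pose c (p : K) (a : nonsimple S) := pairing lam (val a) (val p).1.
pose d (p : K) := fracpart (form y (lam (val p).1)) + (val p).2%:R - 1.
have h0 : cint_cube (fun x => E x - F x) = 0.
  apply: (@cint_cube_null R (nonsimple S) K c d).
  - by move=> p; have /existsP := valP p.
  - exact: cniceB.
  move=> x cx EF; apply: contrapT => off; move/eqP: EF; apply; apply/eqP.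
  rewrite subr_eq0; apply/eqP.
  have [m0 m0P] := fin_all_exists (fun i => exists_layer i cx).
  pose m : mindex S lam := [ffun i => m0 i].
  have mE i : m i = m0 i :> nat by rewrite ffunE.
  have xm : x \in polytope lam (fun i => m i) y.
    rewrite inE; split=> // i; rewrite mE.
    by have [/ltW -> -> _] := m0P i.
  have uniq (m' : mindex S lam) : x \in polytope lam (fun i => m' i) y -> m' = m.
    rewrite inE => -[_ xm']; apply/ffunP => i; apply: val_inj; rewrite /= mE.
    have /andP[l1 l2] := xm' i; have [k1 k2 _] := m0P i.
    have [//|[mm zE]] := layer_cases k1 k2 l1 l2; exfalso.
    have [/existsP ex|/existsPn nex] :=
      boolP [exists a : nonsimple S, pairing lam (val a) i != 0].
      have m'N : (m' i < N)%N.
        exact: leq_trans (ltn_ord (m' i)) (leq_bigmax i).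
      have pP : [exists a : nonsimple S, pairing lam (val a) (i, Ordinal m'N).1 != 0].
        exact/existsP.
      apply: off; exists (Sub (i, Ordinal m'N) pP : K).
      rewrite /hyperplane /= /c /d /= -zE /lform.
      by apply: eq_bigr => a _; rewrite mulrC.
    (* Here the i-th linear form vanishes identically, so [mbound] is 1 and there is no room for an
       index m_i + 1. *)
    have := ltn_ord (m' i); rewrite mm -(ltr_nat R) mboundE// big1 ?addr0.
      by rewrite ltNge ler1n.
    by move=> a _; apply/eqP; have := nex a; rewrite negbK.
  rewrite /F (bigD1 m)//= big1 ?addr0 => [|m' m'm]; last first.
    by rewrite /Q ifF ?mulr0//; apply: contraNF m'm => /uniq ->.
  rewrite /Q xm /E /coef /phi -!cexp_sum -!cexpD; congr cexp.
  (* On the layer the fractional part is {<y, lambda_i>} + m_i - z_i. The constant part goes into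
     [coef], and - t_i z_i, expanded over the non-simple roots, turns t_a into [tstar]. *)
  rewrite [X in _ + X = _](_ : _ = \sum_(i < r) t (simple_root S i) *
       (fracpart (form y (lam i)) + (m i)%:R)%:C -
     \sum_(i < r) t (simple_root S i) * (lform lam x i)%:C); last first.
    rewrite -sumrB; apply: eq_bigr => i _; rewrite -mulrBr -rmorphB mE.
    by have [_ _ ->] := m0P i.
  rewrite addrCA; congr (_ + _).
  under [in RHS]eq_bigr => a _ do rewrite /tstar mulrBl.
  rewrite sumrB; congr (_ - _).
  under eq_bigr => i _ do rewrite /lform rmorph_sum mulr_sumr.
  rewrite exchange_big /=; apply: eq_bigr => a _; rewrite mulr_suml.
  by apply: eq_bigr => i _; rewrite rmorphM /= mulrA mulrAC.
transitivity (cint_cube (fun x => 1 * (E x - F x) + F x)).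
  by congr cint_cube; apply/funext => x; rewrite mul1r subrK.
by rewrite cint_cube_lin ?h0 ?mulr0 ?add0r//; exact: cniceB.
Qed.

End GeneratingFunction.

Theorem theorem4p5 (R : realType) (V : vectType R)
    (form : {dot V for (@idfun R)}) (r : nat) (dimV : \dim {:V} = r)
    (S : based_root_system form r)
    (lam : 'I_r -> V) (lamP : fundamental_weights S lam)
    (t : pos_roots S -> R[i])
    (ht : forall a, `|t a| < (2 * pi)%:C) :
  (forall y : V,
    [/\ genfun_converges lam t y,
        genfun lam t y =
          (\prod_(a : pos_roots S) todd (t a)) *
          cint_cube (fun x : {ffun nonsimple S -> R^o} =>
            (\prod_(a : nonsimple S) cexp (t (val a) * (x a : R)%:C)) *
            \prod_(i < r)
              cexp (t (simple_root S i) *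
                    (fracpart (form y (lam i) - lform lam x i))%:C)),
        genfun lam t y =
          (\prod_(a : pos_roots S) todd (t a)) *
          \sum_(m : mindex S lam)
            cexp (\sum_(i < r) t (simple_root S i) *
                    (fracpart (form y (lam i)) + (m i)%:R)%:C) *
            cint_over (polytope lam (fun i => m i) y)
              (fun x : {ffun nonsimple S -> R^o} =>
                 cexp (\sum_(a : nonsimple S) tstar lam t a * (x a : R)%:C))
      & forall m : 'I_r -> nat, convex_polytope (polytope (S := S) lam m y)]) /\
  (irreducible_roots form (root_set S) -> ~ type_A1 (root_set S) ->
    genfun lam t 0 =
      (\prod_(a : pos_roots S) todd (t a)) *
      \sum_(m : mindex S lam | [forall i, (0 < m i)%N])
        cexp (\sum_(i < r) t (simple_root S i) * (m i)%:R) *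
        cint_over (polytope lam (fun i => m i) 0)
          (fun x : {ffun nonsimple S -> R^o} =>
             cexp (\sum_(a : nonsimple S) tstar lam t a * (x a : R)%:C))).
Proof.
have t2pi a : normc (t a) < 2 * pi by rewrite -ltcR -normc_norm.
have second y : genfun lam t y = (\prod_(a : pos_roots S) todd (t a)) *
    \sum_(m : mindex S lam)
      cexp (\sum_(i < r) t (simple_root S i) *
              (fracpart (form y (lam i)) + (m i)%:R)%:C) *
      cint_over (polytope lam (fun i => m i) y)
        (fun x : {ffun nonsimple S -> R^o} =>
           cexp (\sum_(a : nonsimple S) tstar lam t a * (x a : R)%:C)).
  by rewrite (genfun_cube lam t2pi y) (cint_cube_polytopes lamP).
split=> [y|irr nA1].
  split=> //; first exact: genfun_cvg.
  - exact: genfun_cube.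
  - by move=> m; exact: polytope_convex.
rewrite second; congr (_ * _).
have form0 i : fracpart (form 0 (lam i)) = 0.
  rewrite (_ : form 0 (lam i) = 0) ?/fracpart ?floor0 ?subr0//.
  exact: linear0l.
rewrite (bigID (fun m : mindex S lam => [forall i, (0 < m i)%N])) /=.
rewrite [X in _ + X]big1 ?addr0 => [|m].
  apply: eq_bigr => m _; congr (cexp _ * _); apply: eq_bigr => i _.
  by rewrite form0 add0r rmorph_nat.
(* For y = 0 and m_i = 0 the constraints force the i-th linear form to be at most 0, while on the
   cube it is at least 0. The polytope thus lies in a hyperplane, a genuine one by
   [irreducible_pairing], and its integral vanishes. *)
move=> nm; have [i mi0] : exists i, m i = 0%N :> nat.
  apply: contrapT => h; move/negP: nm; apply; apply/forallP => i.
  by rewrite lt0n; apply/eqP => mi; apply: h; exists i.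
 rewrite cint_over_cube; last exact: polytope_cube.
have [a ai] := irreducible_pairing lamP i irr nA1.
rewrite (@cint_cube_null R (nonsimple S) unit (fun _ a => pairing lam (val a) i)
  (fun=> 0)) ?mulr0//.
- by move=> _; exists a.
- apply: cnice_if; first exact: measurable_polytope.
  apply: cnice_cexp; apply: cnice_sum => b; apply: cniceM; first exact: cnice_cst.
  by apply: cnice_real; exact: nice_coord.
- move=> x cx; case: ifPn => [|_]; last by rewrite eqxx.
  rewrite inE => -[_ /(_ i)]; rewrite form0 mi0 addr0 => /andP[_ z0] _.
  exists tt; rewrite /hyperplane /=.
  have /andP[z1 _] := lform_le lamP i cx.
  transitivity (lform lam x i); last by apply: le_anti; rewrite z0 z1.
  by apply: eq_bigr => b _; rewrite mulrC.
Qed.
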